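(* Let $G=(V,E)$ be an undirected simple graph with $n$ vertices. Let $\Pi$ be any randomized algorithm that, in the random query model, outputs a number $A$ with $|A-\min_{\mathcal{C}}\mathrm{cost}_G(\mathcal{C})|\le \varepsilon n^2$ with probability at least $99/100$. If the worst-case number of queries of $\Pi$ is $q$ and the space used is at most $\gamma\sqrt n$ bits, then $$q=\begin{cases}\Omega\left(\min\left(\frac{n}{\varepsilon^2\sqrt{\gamma}},\frac{n\sqrt n}{\gamma}\right)\right)&\text{if }\gamma<1,\\ \Omega\left(n/\varepsilon^2\right)&\text{if }\gamma\ge 1,\end{cases}$$ for parameters $\varepsilon\in\left(\omega\left(\frac1{\sqrt n}\right),0.05\right)$ and $\gamma>\omega\left(\frac{\log n}{\sqrt n}\right)$.
   Context: A clustering $\mathcal{C}$ is a partition of $V$ into any number of parts; $u\sim_{\mathcal{C}}v$ means same part. $\mathrm{cost}_G(\mathcal{C})=|\{\{u,v\}\notin E: u\sim_{\mathcal{C}}v\}|+|\{\{u,v\}\in E: u\not\sim_{\mathcal{C}}v\}|$. In the random query model, each query returns an independent uniformly random unordered pair $\{u,v\}$ of distinct vertices together with the bit $\mathbb{1}_{\{u,v\}\in E}$; the algorithm processes the query answers one at a time, and its space is the number of bits of memory it maintains between queries. Parameters may depend on $n$; asymptotic notation is as $n\to\infty$. *)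

(* Defs.v *)
From HB Require Import structures.
From mathcomp Require Import all_boot all_order all_algebra.
From mathcomp Require Import all_classical all_reals all_analysis.

Set Implicit Arguments.
Unset Strict Implicit.
Unset Printing Implicit Defensive.

Import Order.TTheory GRing.Theory Num.Theory.
Import numFieldNormedType.Exports.

Local Open Scope ring_scope.
Local Open Scope classical_set_scope.

Section Graphs.
Variable n : nat.

Definition vpair := {e : {set 'I_n} | #|e| == 2%N}.

Record sgraph := SGraph {
  edges : {set {set 'I_n}};
  edges_card2 : forall e, e \in edges -> #|e| = 2%N }.

Definition adjacent (G : sgraph) (p : vpair) : bool := val p \in edges G.

Definition clustering (C : {set {set 'I_n}}) : bool :=
  finset.partition C [set: 'I_n]%SET.

Definition same_part (C : {set {set 'I_n}}) (p : vpair) : bool :=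
  [exists B in C, val p \subset B].

Definition cost (G : sgraph) (C : {set {set 'I_n}}) : nat :=
  (#|[pred p : vpair | ~~ adjacent G p & same_part C p]|
   + #|[pred p : vpair | adjacent G p & ~~ same_part C p]|)%N.

Definition singleton_parts : {set {set 'I_n}} :=
  [set (finset.set1 v) | v : 'I_n]%SET.

(* The clustering into singletons is only the default value required by
   [arg min]; see min_cost_attained and min_cost_le. *)
Definition min_cost (G : sgraph) : nat :=
  cost G [arg min_(C < singleton_parts | clustering C) cost G C]%N.

Lemma clustering_singleton_parts : clustering singleton_parts.
Proof.
apply/and3P; split.
- rewrite finset.eqEsubset finset.subsetT /=; apply/fintype.subsetP => v _.
  apply/finset.bigcupP; exists (finset.set1 v); last by rewrite finset.set11.
  by apply/imsetP; exists v.
- apply/finset.trivIsetP => A B /imsetP[u _ ->] /imsetP[v _ ->] neq.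
  rewrite disjoints1 finset.in_set1; apply: contra neq => /eqP ->.
  exact: eqxx.
- apply/negP => /imsetP[v _ /finset.setP/(_ v)].
  by rewrite finset.in_set0 finset.set11.
Qed.

Lemma min_cost_attained G : exists2 C, clustering C & cost G C = min_cost G.
Proof.
rewrite /min_cost; case: arg_minnP => [|C hC _]; last by exists C.
exact: clustering_singleton_parts.
Qed.

Lemma min_cost_le G C : clustering C -> (min_cost G <= cost G C)%N.
Proof.
rewrite /min_cost; case: arg_minnP => [|C' _ hmin]; last exact: hmin.
exact: clustering_singleton_parts.
Qed.

End Graphs.

Section Algorithms.
Variable R : realType.

(* inl m : go on to the next query with memory m; inr a : stop and output a. *)
Definition outcome (s : nat) : Type := (s.-tuple bool + R)%type.

Definition measurable_outcome (d : measure_display) (T : measurableType d)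
    (s : nat) (f : T -> outcome s) : Prop :=
  (forall m, measurable [set w | f w = inl m]) /\
  (forall B : set R, measurable B ->
     measurable [set w | exists2 a, B a & f w = inr a]).

(* A randomized algorithm on n-vertex graphs with s bits of memory is a random
   member, indexed by a seed, of the family of all deterministic ones.  Neither
   the seed nor the number of queries made so far (the nat argument of step) is
   charged to the memory; in particular step may use fresh coins at every
   query. *)
Record rand_alg (n s : nat) := RandAlg {
  seed_disp : measure_display;
  seed : measurableType seed_disp;
  seed_prob : probability seed R;
  start : seed -> outcome s;
  step : seed -> nat -> s.-tuple bool -> vpair n -> bool -> outcome s;
  start_measurable : measurable_outcome start;
  step_measurable : forall t m p b,
    measurable_outcome (fun w => step w t m p b) }.

Section Execution.
Variables n s : nat.
Variables (A : rand_alg n s) (G : sgraph n).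

Fixpoint run_from (w : seed A) (t : nat) (o : outcome s)
    (ps : seq (vpair n)) : outcome s :=
  if ps is p :: ps' then
    run_from w t.+1
      (match o with
       | inl m => step w t m p (adjacent G p)
       | inr a => inr a
       end) ps'
  else o.

(* Once the algorithm has stopped, the remaining pairs are ignored. *)
Definition run (w : seed A) (ps : seq (vpair n)) : outcome s :=
  run_from w 0 (start w) ps.

Definition accurate (eps : R) (w : seed A) (ps : seq (vpair n)) : Prop :=
  exists2 a : R, run w ps = inr a &
    `|a - (min_cost G)%:R| <= eps * n%:R ^+ 2.

(* Probability over the seed and, independently, q independent uniform pairs,
   i.e. a uniform q-tuple of pairs. *)
Definition success_prob (eps : R) (q : nat) : R :=
  (\sum_(ps : q.-tuple (vpair n))
     fine (seed_prob A [set w | accurate eps w ps]))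
  / #|{: q.-tuple (vpair n)}|%:R.

End Execution.

Definition at_most_queries n s (A : rand_alg n s) (q : nat) : Prop :=
  forall (G : sgraph n) (w : seed A) (ps : q.-tuple (vpair n)),
    exists a : R, run G w ps = inr a.

Definition query_lower_bound (eps gamma : R) (n : nat) : R :=
  if gamma < 1 then
    Num.min (n%:R / (eps ^+ 2 * Num.sqrt gamma))
            (n%:R * Num.sqrt n%:R / gamma)
  else n%:R / eps ^+ 2.

End Algorithms.

(* Main.v *)
(** Plant a bipartition [x] of the vertices: a pair [p] is an edge
    with bias [be = 12 eps] towards agreeing with [x], independently of the others;
    the null law is [be = 0].  The minimum cost under the planted law is smaller
    than under the null law by more than [2 eps n^2], so an accurate algorithm
    distinguishes the two laws.  By averaging over the seed we may fix it.

    With [s] bits of memory ([gamma < 1]), compare the memory with the one obtained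
    when every answer is a fresh fair coin.  If [V] is the final acceptance
    probability under fresh coins seen from the current memory, then the potential
    [V - th V^2] increases in one query by at most the mean square bias of the next
    answer given the memory, divided by [4 th].  Conditioning on a memory state of
    probability [nu] gives the labels, up to the planted signs, a mean square bias
    [O(log (1 / nu) / n^2)] (level-1 inequality), and the planted signs contribute
    [O(be^2 log^2 (1 / nu) / n^2)] (level-2 inequality, from the exponential moment
    of a Rademacher chaos).  Summing over [q] queries gives
    [q (s + eps^2 s^2) / n^2 = Omega(1)].

    Without a memory bound, the chi-square distance between the two laws of the
    answers is at most [E exp (q be^2 E_p[x_p]) - 1], again an exponential moment of
    a chaos, which is small unless [q = Omega(n / eps^2)]. *)
Require Import Defs.
From HB Require Import structures.
From mathcomp Require Import all_boot all_order all_algebra.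
From mathcomp Require Import all_classical all_reals all_analysis.
From mathcomp Require Import measurable_realfun.
From mathcomp Require Import ring lra.

Set Implicit Arguments.
Unset Strict Implicit.
Unset Printing Implicit Defensive.

Import Order.TTheory GRing.Theory Num.Theory.
Import numFieldNormedType.Exports.

Local Open Scope ring_scope.
Local Open Scope classical_set_scope.

Lemma eq_ler (R : realType) (x y : R) : x = y -> x <= y.
Proof. by move=> ->. Qed.

(** * Elementary exponential inequalities *)

Section ExponentialBounds.
Variable R : realType.
Implicit Types x y a c : R.

(** Multiplied by [1 - x], the left side is at most [1] and the right side is
    [1 + x ^+ 2 * (1 - 2 * x)]. *)
Lemma expR_le_quadratic x : x <= 1 / 2 -> expR x <= 1 + x + 2 * x ^+ 2.
Proof.
move=> x_le; have x1 : 0 < 1 - x by lra.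
rewrite -(ler_pM2r x1); apply: (@le_trans _ _ 1); last by nra.
have h := ler_wpM2l (ltW (expR_gt0 x)) (expR_ge1Dx (- x)).
by apply: le_trans h _; rewrite -expRD subrr expR0.
Qed.

(** Quadratic bounds for [y] and [- y] settle small [y]; beyond [1 / 2] one has
    [y <= 2 * y ^+ 2]. *)
Lemma cosh_le_gauss y : (expR y + expR (- y)) / 2 <= expR (2 * y ^+ 2).
Proof.
wlog y0 : y / 0 <= y => [h|].
  case: (leP 0 y) => [|y0]; first exact: h.
  by have := h (- y); rewrite opprK addrC sqrrN; apply; lra.
case: (leP y (1 / 2)) => y1.
  have h1 := expR_le_quadratic y1.
  have h2 : expR (- y) <= 1 - y + 2 * y ^+ 2.
    by rewrite -(sqrrN y); apply: expR_le_quadratic; lra.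
  by apply: le_trans (expR_ge1Dx _); lra.
apply: (@le_trans _ _ (expR y)).
  have : expR (- y) <= expR y by rewrite ler_expR; lra.
  lra.
by rewrite ler_expR; nra.
Qed.

(* Symmetrize: by Jensen the centering costs at most a factor cosh. *)
Lemma two_point_mgf a c : -1 <= c <= 1 ->
  (1 + c) / 2 * expR (a * (1 - c)) + (1 - c) / 2 * expR (a * (-1 - c))
    <= expR (8 * a ^+ 2).
Proof.
move=> /andP[c0 c1].
have jensen : expR (a * - c) <=
    (1 + c) / 2 * expR (- a) + (1 - c) / 2 * expR a.
  have tangent z : expR (a * - c) * (1 + (z - a * - c)) <= expR z.
    rewrite -[z in leRHS](subrK (a * - c)) [X in _ <= expR X]addrC expRD.
    by rewrite ler_pM2l ?expR_gt0// expR_ge1Dx.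
  have k1 := ler_wpM2l (_ : 0 <= (1 + c) / 2) (tangent (- a)).
  have k2 := ler_wpM2l (_ : 0 <= (1 - c) / 2) (tangent a).
  apply: le_trans (lerD (k1 _) (k2 _)); lra.
have -> : a * (1 - c) = a * - c + a by ring.
have -> : a * (-1 - c) = a * - c + - a by ring.
rewrite !expRD.
have ch : (expR a * expR a + expR (- a) * expR (- a)) / 2 <= expR (8 * a ^+ 2).
  rewrite -!expRD; have := cosh_le_gauss (a + a).
  by rewrite opprD (_ : 2 * (a + a) ^+ 2 = 8 * a ^+ 2) //; ring.
have ee : expR a * expR (- a) = 1 by rewrite -expRD subrr expR0.
apply: le_trans ch.
have ea := expR_gt0 a; have eb := expR_gt0 (- a).
move: ea eb ee jensen.
set A := expR a; set B := expR (- a); set e := expR _ => A0 B0 AB je.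
have m0 : 0 <= (1 + c) / 2 * A + (1 - c) / 2 * B.
  by apply: addr_ge0; apply: mulr_ge0; lra.
have := ler_wpM2r m0 je.
(* This is a mixture of [A * B = 1] and [(A ^+ 2 + B ^+ 2) / 2]; the latter is the larger and is
   bounded in [ch]. *)
have -> : ((1 + c) / 2 * B + (1 - c) / 2 * A) * ((1 + c) / 2 * A + (1 - c) / 2 * B)
  = (1 + c ^+ 2) / 2 * (A * B) + (1 - c ^+ 2) / 4 * (A ^+ 2 + B ^+ 2) by field.
rewrite AB => h.
have -> : (1 + c) / 2 * (e * A) + (1 - c) / 2 * (e * B)
  = e * ((1 + c) / 2 * A + (1 - c) / 2 * B) by ring.
apply: le_trans h _.
have : 0 <= (A - B) ^+ 2 by exact: sqr_ge0.
have -> : (A - B) ^+ 2 = A ^+ 2 + B ^+ 2 - 2 * (A * B) by ring.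
rewrite AB -!expr2 => h.
have := mulr_ge0 (sqr_ge0 c) h; lra.
Qed.

End ExponentialBounds.

(** * Uniform averages over finite types *)

Section Mean.
Variable R : realType.

Definition mean (T : finType) (F : T -> R) : R := (\sum_x F x) / #|T|%:R.

Lemma eq_mean (T : finType) (F G : T -> R) : F =1 G -> mean F = mean G.
Proof. by move=> FG; rewrite /mean (eq_bigr G). Qed.

Lemma le_mean (T : finType) (F G : T -> R) :
  (forall x, F x <= G x) -> mean F <= mean G.
Proof. by move=> FG; rewrite ler_wpM2r ?invr_ge0// ler_sum. Qed.

Lemma meanD (T : finType) (F G : T -> R) :
  mean (fun x => F x + G x) = mean F + mean G.
Proof. by rewrite /mean big_split mulrDl. Qed.

Lemma meanZ (T : finType) c (F : T -> R) : mean (fun x => c * F x) = c * mean F.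
Proof. by rewrite /mean -mulr_sumr mulrA. Qed.

Lemma mean_cst (T : finType) (c : R) : (0 < #|T|)%N -> mean (fun _ : T => c) = c.
Proof.
by move=> T0; rewrite /mean sumr_const -(mulr_natr c) mulfK// pnatr_eq0 -lt0n.
Qed.

Lemma mean_sum (T I : finType) (F : I -> T -> R) :
  mean (fun x => \sum_i F i x) = \sum_i mean (F i).
Proof. by rewrite /mean exchange_big /= mulr_suml. Qed.

Lemma mean_mean (T I : finType) (F : T -> I -> R) :
  mean (fun x => mean (F x)) = mean (fun i => mean (F ^~ i)).
Proof.
rewrite /mean -mulr_suml exchange_big /= -[X in _ = X / _]mulr_suml.
by rewrite mulrAC.
Qed.

Lemma mean_ge0 (T : finType) (F : T -> R) : (forall x, 0 <= F x) -> 0 <= mean F.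
Proof. by move=> F0; rewrite divr_ge0// sumr_ge0. Qed.

Lemma mean_inj (T : finType) (F : T -> R) (f : T -> T) :
  injective f -> mean (F \o f) = mean F.
Proof. by move=> fI; rewrite /mean [in RHS](reindex_inj fI). Qed.

End Mean.

(** * Random signs and exponential moments of their quadratic forms *)

Section Signs.
Variable R : realType.

Definition sg (b : bool) : R := if b then 1 else -1.

Lemma sg_sqr b : sg b * sg b = 1.
Proof. by case: b; rewrite /sg ?mulrNN mulr1. Qed.

Lemma sgN b : sg (~~ b) = - sg b.
Proof. by case: b; rewrite /sg ?opprK. Qed.

Section Flip.
Variable T : finType.
Implicit Types (x : {ffun T -> bool}) (v : T).

Definition flip v x : {ffun T -> bool} :=
  [ffun u => if u == v then ~~ x u else x u].

Lemma flipK v : involutive (flip v).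
Proof. by move=> x; apply/ffunP => u; rewrite !ffunE; case: eqP; rewrite ?negbK. Qed.

Lemma card_signs_gt0 : (0 < #|{ffun T -> bool}|)%N.
Proof. by rewrite card_ffun card_bool expn_gt0. Qed.

Lemma mean_flip v (F : {ffun T -> bool} -> R) :
  mean F = mean (fun x => (F x + F (flip v x)) / 2).
Proof.
rewrite [RHS](eq_mean (G := fun x => 2^-1 * (F x + (F \o flip v) x))); last first.
  by move=> x /=; rewrite mulrC.
rewrite meanZ meanD (mean_inj F (can_inj (flipK v))); lra.
Qed.

Lemma mean_sg2 (a b : T) :
  mean (fun x : {ffun T -> bool} => sg (x a) * sg (x b)) = (a == b)%:R.
Proof.
case: (eqVneq a b) => [->|ab].
  rewrite (eq_mean (G := fun=> 1)) ?mean_cst ?card_signs_gt0// => x.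
  exact: sg_sqr.
rewrite (mean_flip a) (eq_mean (G := fun=> 0)) ?mean_cst ?card_signs_gt0// => x.
by rewrite !ffunE eqxx eq_sym (negbTE ab) sgN mulNr subrr mul0r.
Qed.

End Flip.

Lemma sum_sumD1 (T : finType) (v : T) (F : T -> T -> R) :
  \sum_u \sum_w F u w = F v v + \sum_(u | u != v) (F u v + F v u)
    + \sum_(u | u != v) \sum_(w | w != v) F u w.
Proof.
rewrite (bigD1 v) //= (bigD1 v) //=.
have -> : \sum_(u | u != v) \sum_w F u w
    = \sum_(u | u != v) F u v + \sum_(u | u != v) \sum_(w | w != v) F u w.
  by rewrite -big_split; apply: eq_bigr => u _; rewrite [LHS](bigD1 v).
by rewrite big_split /=; ring.
Qed.

(* Averaging out one sign turns its linear coefficient into a rank-one update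
   of the remaining matrix; for a small Frobenius norm this update is paid for
   by the removed row and column. *)
Lemma chaos_mgf_supported (T : finType) k (S : {set T}) (A : T -> T -> R) :
    (#|S| <= k)%N ->
    (forall u w, ~~ ((u \in S) && (w \in S)) -> A u w = 0) ->
    \sum_u \sum_w A u w ^+ 2 <= 1 / 256 ->
  mean (fun x : {ffun T -> bool} =>
      expR (\sum_u \sum_w A u w * (sg (x u) * sg (x w))))
    <= expR (\sum_u A u u + 10 * \sum_u \sum_w A u w ^+ 2).
Proof.
elim: k S A => [|k IH] S A.
  rewrite leqn0 cards_eq0 => /eqP -> A0 _.
  have {}A0 u w : A u w = 0 by apply: A0; rewrite !inE.
  rewrite (eq_mean (G := fun=> 1)); last first.
    by move=> x; rewrite big1 ?expR0// => u _; rewrite big1// => w _; rewrite A0 mul0r.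
  rewrite mean_cst ?card_signs_gt0// -[leLHS]expR0 ler_expR.
  by rewrite addr_ge0 ?mulr_ge0 ?sumr_ge0// => u _; rewrite ?A0// sumr_ge0// => w _; rewrite sqr_ge0.
move=> Sk AS A256.
have [S0|[v vS]] := set_0Vmem S.
  by apply: (IH S) => //; rewrite S0 cards0.
pose c u := A u v + A v u.
(* [c] holds the coefficients of the linear form [l] multiplying the sign at [v]; the [2] comes from
   [cosh_le_gauss], which leaves [2 * l ^+ 2] in the exponent. *)
pose A' u w := if (u != v) && (w != v) then A u w + 2 * (c u * c w) else 0.
have A'sum (F : T -> T -> R -> R) : (forall u w, F u w 0 = 0) ->
    \sum_u \sum_w F u w (A' u w) =
    \sum_(u | u != v) \sum_(w | w != v) F u w (A u w + 2 * (c u * c w)).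
  move=> F0; rewrite [RHS]big_mkcond; apply: eq_bigr => u _; rewrite /A'.
  case: (u != v) => /=; last by rewrite big1// => w _.
  by rewrite [RHS]big_mkcond; apply: eq_bigr => w _; case: (w != v).
pose s := \sum_(u | u != v) c u ^+ 2.
pose B := \sum_(u | u != v) \sum_(w | w != v) A u w ^+ 2.
pose be := \sum_(u | u != v) (A u v ^+ 2 + A v u ^+ 2).
have normA : \sum_u \sum_w A u w ^+ 2 = A v v ^+ 2 + be + B by exact: sum_sumD1.
have s_be : s <= 2 * be.
  rewrite /s /be mulr_sumr; apply: ler_sum => u _.
  by rewrite /c; have := sqr_ge0 (A u v - A v u); nra.
have s0 : 0 <= s by apply: sumr_ge0 => u _; exact: sqr_ge0.
have B0 : 0 <= B by apply: sumr_ge0 => u _; apply: sumr_ge0 => w _; exact: sqr_ge0.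
have be0 : 0 <= be by apply: sumr_ge0 => u _; rewrite addr_ge0// sqr_ge0.
have Avv0 := sqr_ge0 (A v v).
have normA' : \sum_u \sum_w A' u w ^+ 2 <= B + 9 / 32 * s.
  rewrite (A'sum (fun _ _ a => a ^+ 2)); last by move=> *; rewrite expr0n.
  have [s_eq0|s_neq0] := eqVneq s 0.
    have c0 u : u != v -> c u = 0.
      move=> uv; apply/eqP; rewrite -sqrf_eq0; apply/eqP.
      by apply: (psumr_eq0P _ s_eq0) => // w _; exact: sqr_ge0.
    rewrite s_eq0 mulr0 addr0; apply: ler_sum => u uv; apply: ler_sum => w _.
    by rewrite (c0 u uv) mul0r mulr0 addr0.
  have s_gt0 : 0 < s by rewrite lt_def s_neq0.
  (* Young's inequality with weight [32 * s]. As [B <= 1 / 256] and [s <= 1 / 128], the excess is at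
     most [s / 8 + s / 32 + s / 8]. The weight degenerates at [s = 0], treated above. *)
  apply: (@le_trans _ _ (\sum_(u | u != v) \sum_(w | w != v)
      ((1 + 32 * s) * A u w ^+ 2 + (4 + 1 / (8 * s)) * (c u ^+ 2 * c w ^+ 2)))).
    apply: ler_sum => u _; apply: ler_sum => w _.
    set a := A u w; set z := c u * c w.
    have -> : c u ^+ 2 * c w ^+ 2 = z ^+ 2 by rewrite exprMn.
    rewrite -subr_ge0.
    have -> : (1 + 32 * s) * a ^+ 2 + (4 + 1 / (8 * s)) * z ^+ 2
        - (a + 2 * z) ^+ 2 = (16 * s * a - z) ^+ 2 / (8 * s) by field.
    by rewrite divr_ge0 ?sqr_ge0// mulr_ge0// ltW.
  under eq_bigr do rewrite big_split -!mulr_sumr /=.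
  rewrite big_split -!mulr_sumr -/B /=.
  rewrite -mulr_suml -/s.
  have -> : (4 + 1 / (8 * s)) * (s * s) = 4 * s ^+ 2 + s / 8 by field.
  nra.
have normA'256 : \sum_u \sum_w A' u w ^+ 2 <= 1 / 256.
  by apply: le_trans normA' _; rewrite normA in A256; lra.
pose l (x : {ffun T -> bool}) := \sum_(u | u != v) c u * sg (x u).
pose Q0 (x : {ffun T -> bool}) :=
  \sum_(u | u != v) \sum_(w | w != v) A u w * (sg (x u) * sg (x w)).
have quad (x : {ffun T -> bool}) : \sum_u \sum_w A u w * (sg (x u) * sg (x w))
    = A v v + sg (x v) * l x + Q0 x.
  rewrite (sum_sumD1 v) sg_sqr mulr1; congr (_ + _ + _).
  by rewrite mulr_sumr; apply: eq_bigr => u _; rewrite /c; ring.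
have flip_eq (x : {ffun T -> bool}) u : u != v -> flip v x u = x u by move=> /negbTE uv; rewrite ffunE uv.
have l_flip x : l (flip v x) = l x by apply: eq_bigr => u uv; rewrite flip_eq.
have Q0_flip x : Q0 (flip v x) = Q0 x.
  by apply: eq_bigr => u uv; apply: eq_bigr => w wv; rewrite !flip_eq.
have quad' (x : {ffun T -> bool}) : \sum_u \sum_w A' u w * (sg (x u) * sg (x w)) = Q0 x + 2 * l x ^+ 2.
  rewrite (A'sum (fun u w a => a * (sg (x u) * sg (x w)))); last by move=> *; rewrite mul0r.
  rewrite expr2 /l mulr_suml mulr_sumr -big_split; apply: eq_bigr => u _ /=.
  rewrite 2!mulr_sumr -big_split; apply: eq_bigr => w _ /=; ring.
rewrite (mean_flip v).
apply: (@le_trans _ _ (expR (A v v) * mean (fun x : {ffun T -> bool} =>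
      expR (\sum_u \sum_w A' u w * (sg (x u) * sg (x w)))))).
  rewrite -meanZ; apply: le_mean => x; rewrite quad' !quad l_flip Q0_flip.
  rewrite ffunE eqxx sgN mulNr !(addrAC _ _ (Q0 x)).
  rewrite (expRD _ (sg _ * _)) (expRD _ (- _)) -mulrDr -mulrA.
  have -> : expR (A v v) * expR (Q0 x + 2 * l x ^+ 2)
      = expR (A v v + Q0 x) * expR (2 * l x ^+ 2) by rewrite -!expRD addrA.
  rewrite ler_pM2l ?expR_gt0//.
  have -> : l x ^+ 2 = (sg (x v) * l x) ^+ 2 by rewrite exprMn (expr2 (sg _)) sg_sqr mul1r.
  exact: cosh_le_gauss.
apply: (@le_trans _ _ (expR (A v v) * expR (\sum_u A' u u + 10 * \sum_u \sum_w A' u w ^+ 2))).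
  rewrite ler_pM2l ?expR_gt0//; apply: (IH (S :\ v)%SET) => //.
    by move: Sk; rewrite (cardsD1 v) vS.
  move=> u w; rewrite !inE /A'; case: (u != v) (w != v) => [] [] //= uw.
  have uS : A u w = 0 by exact: AS.
  rewrite uS add0r /c; move: uw; rewrite negb_and => /orP[]/negbTE h.
    by rewrite [A u v]AS ?[A v u]AS ?h ?andbF// addr0 mul0r mulr0.
  by rewrite [A w v]AS ?[A v w]AS ?h ?andbF// addr0 !mulr0.
(* Removing [v] frees [10 * be >= 5 * s]; the update costs [2 * s] on the diagonal and [90 / 32 * s]
   in the norm term. *)
rewrite -expRD ler_expR normA.
have -> : \sum_u A u u = A v v + \sum_(u | u != v) A u u by rewrite (bigD1 v).
have -> : \sum_u A' u u = \sum_(u | u != v) A u u + 2 * s.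
  rewrite /s mulr_sumr -big_split [RHS]big_mkcond; apply: eq_bigr => u _ /=.
  by rewrite /A'; case: (u != v) => //=; rewrite expr2.
move: normA'; lra.
Qed.

Lemma chaos_mgf (T : finType) (A : T -> T -> R) :
    \sum_u \sum_w A u w ^+ 2 <= 1 / 256 ->
  mean (fun x : {ffun T -> bool} =>
      expR (\sum_u \sum_w A u w * (sg (x u) * sg (x w))))
    <= expR (\sum_u A u u + 10 * \sum_u \sum_w A u w ^+ 2).
Proof.
by apply: (@chaos_mgf_supported _ #|T| [set: T]%SET) => [|u w];
  rewrite ?cardsT// !inE.
Qed.

End Signs.

(** * Level inequalities from exponential moments *)

Section LevelInequalities.
Variables (R : realType) (Om : finType) (W w : Om -> R).
Hypothesis W_ge0 : forall o, 0 <= W o.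
Hypothesis w01 : forall o, 0 <= w o <= 1.

Let nu := \sum_o W o * w o.
Hypothesis nu_gt0 : 0 < nu.

(** Jensen under the law proportional to [W * w]: [c] is the mean of [f] there, the tangent to [exp]
    at [c] bounds [nu * exp c] by the mean of [w * exp f], and [w <= 1] removes the factor [w]. *)
Lemma gibbs_variational (f : Om -> R) K :
  \sum_o W o * expR (f o) <= expR K ->
  \sum_o W o * w o * f o <= nu * (K - ln nu).
Proof.
move=> mgf; pose c := (\sum_o W o * w o * f o) / nu.
have nu0 : nu != 0 by rewrite gt_eqF.
rewrite -(divfK nu0 (\sum_o _)) -/c mulrC ler_pM2l// -ler_expR expRD expRN.
rewrite lnK ?posrE// ler_pdivlMr//; apply: le_trans mgf.
have -> : expR c * nu = \sum_o W o * w o * (expR c * (1 + (f o - c))).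
  under eq_bigr do rewrite mulrCA mulrDr mulr1 mulrBr.
  rewrite -mulr_sumr big_split sumrB -mulr_suml -/nu /=.
  by rewrite /c mulrCA divff// mulr1 subrr addr0.
apply: ler_sum => o _; rewrite -mulrA ler_wpM2l//.
have /andP[w0 w1] := w01 o.
apply: (@le_trans _ _ (w o * expR (f o))); last first.
  by rewrite ler_piMl// ltW// expR_gt0.
rewrite ler_wpM2l// -[f o in leRHS](subrK c) [X in _ <= expR X]addrC expRD.
by rewrite ler_pM2l ?expR_gt0// expR_ge1Dx.
Qed.

Lemma correlation_sum (P : finType) (z : P -> Om -> R) (a : P -> R) :
  \sum_o W o * w o * (\sum_p a p * z p o)
    = \sum_p a p * \sum_o W o * w o * z p o.
Proof.
under eq_bigr do rewrite mulr_sumr.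
rewrite exchange_big; apply: eq_bigr => p _; rewrite mulr_sumr.
by apply: eq_bigr => o _; rewrite mulrCA.
Qed.

(** The coefficient [e p / (16 * nu)] maximizes the gain [a * e p] minus the cost [8 * nu * a ^+ 2];
    half of the gain survives. *)
Lemma level1_inequality (P : finType) (z : P -> Om -> R) :
  (forall a : P -> R, \sum_o W o * expR (\sum_p a p * z p o)
     <= expR (8 * \sum_p a p ^+ 2)) ->
  \sum_p (\sum_o W o * w o * z p o) ^+ 2 <= 32 * nu ^+ 2 * - ln nu.
Proof.
move=> mgf; set e := fun p => \sum_o W o * w o * z p o.
have := gibbs_variational (mgf (fun p => e p / (16 * nu))).
rewrite correlation_sum -/e.
have -> : \sum_p e p / (16 * nu) * e p = (\sum_p e p ^+ 2) / (16 * nu).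
  by rewrite mulr_suml; apply: eq_bigr => p _; rewrite expr2 mulrAC.
have -> : \sum_p (e p / (16 * nu)) ^+ 2 = (\sum_p e p ^+ 2) / (16 * nu) ^+ 2.
  by rewrite mulr_suml; apply: eq_bigr => p _; rewrite exprMn exprVn.
set S := \sum_p _; rewrite -(ler_pM2r (_ : 0 < 32 * nu)); last by rewrite mulr_gt0.
have nu0 : nu != 0 by rewrite gt_eqF.
have -> : S / (16 * nu) * (32 * nu) = 2 * S by field.
have -> : nu * (8 * (S / (16 * nu) ^+ 2) - ln nu) * (32 * nu)
  = S + 32 * nu ^+ 2 * - ln nu by field.
lra.
Qed.

(** The moment bound is available only up to squared norm [1 / 256], so the correlation vector is
    rescaled to norm exactly [1 / 16]. This makes the result quadratic in [ln nu]. *)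
Lemma level2_inequality (P : finType) (z : P -> Om -> R) :
  (forall a : P -> R, \sum_p a p ^+ 2 <= 1 / 256 ->
     \sum_o W o * expR (\sum_p a p * z p o) <= expR (10 * \sum_p a p ^+ 2)) ->
  \sum_p (\sum_o W o * w o * z p o) ^+ 2 <= 256 * nu ^+ 2 * (1 - ln nu) ^+ 2.
Proof.
move=> mgf; set e := fun p => \sum_o W o * w o * z p o.
set S := \sum_p _; have S0 : 0 <= S by apply: sumr_ge0 => p _; exact: sqr_ge0.
have [->|S_neq0] := eqVneq S 0.
  apply: mulr_ge0; last exact: sqr_ge0.
  by have := sqr_ge0 nu; lra.
have r0 : 0 < Num.sqrt S by rewrite sqrtr_gt0 lt_def S_neq0.
have r_neq0 : Num.sqrt S != 0 by rewrite gt_eqF.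
have SE : S = Num.sqrt S ^+ 2 by rewrite sqr_sqrtr.
have norm : \sum_p (e p / (16 * Num.sqrt S)) ^+ 2 = 1 / 256.
  under eq_bigr do rewrite exprMn exprVn.
  by rewrite -mulr_suml -/S {1}SE; field.
have := gibbs_variational (mgf _ (_ : \sum_p (e p / (16 * Num.sqrt S)) ^+ 2 <= 1 / 256)).
rewrite norm correlation_sum -/e => /(_ (lexx _)).
have -> : \sum_p e p / (16 * Num.sqrt S) * e p = Num.sqrt S / 16.
  under eq_bigr do rewrite mulrAC -expr2.
  by rewrite -mulr_suml -/S {1}SE; field.
move=> h; have {}h : Num.sqrt S <= 16 * nu * (1 - ln nu).
  by move: nu_gt0 h; move: nu (ln nu) => v l; lra.
have -> : 256 * nu ^+ 2 * (1 - ln nu) ^+ 2 = (16 * nu * (1 - ln nu)) ^+ 2 by ring.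
rewrite SE; apply: lerXn2r => //; rewrite nnegrE ?(ltW r0)//.
exact: le_trans (ltW r0) h.
Qed.

End LevelInequalities.

(** * Moments of the information content of a finite law *)

Section Entropy.
Variables (R : realType) (St : finType) (nu : St -> R).
Hypothesis nu_ge0 : forall m, 0 <= nu m.
Hypothesis nu_sum1 : \sum_m nu m = 1.

Let K : R := #|St|%:R.

Let K_gt0 : 0 < K.
Proof.
rewrite ltr0n lt0n; apply/negP => /eqP/card0_eq St0.
move: nu_sum1; rewrite big1 => [/eqP|m]; last by have := St0 m.
by rewrite eq_sym oner_eq0.
Qed.

Let sum_invK : \sum_(m : St) K^-1 = 1.
Proof. by rewrite sumr_const -mulr_natl divff// gt_eqF. Qed.

Let nu_le1 m : nu m <= 1.
Proof. by rewrite -nu_sum1 (bigD1 m)//= lerDl sumr_ge0. Qed.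

Let lnK_nu m : 0 < nu m -> - ln (nu m) = ln K + ln (K * nu m)^-1.
Proof.
move=> m0; rewrite lnV ?posrE ?mulr_gt0// lnM ?posrE// opprD addrA subrr.
by rewrite add0r.
Qed.

(** Comparison with the uniform law: [- ln nu = ln K + ln y] for [y = 1 / (K * nu)], then
    [ln y <= y], and the terms [nu * y = 1 / K] sum to [1]. *)
Lemma entropy_le : \sum_m nu m * - ln (nu m) <= ln K + 1.
Proof.
have -> : ln K + 1 = \sum_m (nu m * ln K + K^-1).
  by rewrite big_split sum_invK -mulr_suml nu_sum1 mul1r.
apply: ler_sum => m _; have := nu_ge0 m; rewrite le_eqVlt => /orP[/eqP <-|m0].
  by rewrite !mul0r add0r invr_ge0 ltW.
rewrite lnK_nu// mulrDr lerD2l.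
have y0 : 0 < (K * nu m)^-1 by rewrite invr_gt0 mulr_gt0.
apply: le_trans (ler_wpM2l (nu_ge0 m) (ltW (ln_sublinear y0))) _.
by rewrite invfM mulrCA divff ?mulr1 ?gt_eqF.
Qed.

(** The same splitting, now with [ln y <= 2 * sqrt y], so that the squared logarithm still costs
    only a multiple of [y]. *)
Lemma sqr_entropy_le :
  \sum_m nu m * (1 - ln (nu m)) ^+ 2 <= 4 * ln K ^+ 2 + 18.
Proof.
have -> : 4 * ln K ^+ 2 + 18 = \sum_m (nu m * (2 + 4 * ln K ^+ 2) + 16 * K^-1).
  by rewrite big_split -mulr_sumr sum_invK -mulr_suml nu_sum1 /=; ring.
apply: ler_sum => m _; have := nu_ge0 m; rewrite le_eqVlt => /orP[/eqP <-|m0].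
  by rewrite !mul0r add0r mulr_ge0 ?invr_ge0 ?ltW.
have y0 : 0 < (K * nu m)^-1 by rewrite invr_gt0 mulr_gt0.
have -> : K^-1 = nu m * (K * nu m)^-1.
  by rewrite invfM mulrCA divff ?mulr1 ?gt_eqF.
rewrite [16 * _]mulrCA -mulrDr ler_pM2l// lnK_nu// -[ln K + _]opprK opprK.
have L0 : 0 <= ln K + ln (K * nu m)^-1.
  by rewrite -lnK_nu// oppr_ge0 ln_le0.
move: L0; set y := (K * nu m)^-1 in y0 *.
have := ln_sublinear (_ : 0 < Num.sqrt y); rewrite sqrtr_gt0 => /(_ y0).
have : ln y = 2 * ln (Num.sqrt y).
  by rewrite -[in LHS](sqr_sqrtr (ltW y0)) lnXn ?sqrtr_gt0// mulr_natl.
have : y = Num.sqrt y ^+ 2 by rewrite sqr_sqrtr ?ltW.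
have : 0 <= Num.sqrt y by exact: sqrtr_ge0.
move: (Num.sqrt y) (ln (Num.sqrt y)) (ln K) => t l k t0 yt -> lt L0; rewrite yt.
have : (k + 2 * l) ^+ 2 <= (k + 2 * t) ^+ 2.
  by apply: lerXn2r; rewrite ?nnegrE; lra.
have := sqr_ge0 (k - 2 * t); have := sqr_ge0 (k + 2 * l - 1); nra.
Qed.

End Entropy.

(** * The planted law of signs and labels *)

Section PlantedLaw.
Variables (R : realType) (n : nat).
Local Notation signs := {ffun 'I_n -> bool}.
Local Notation labels := {ffun vpair n -> bool}.
Local Notation sg := (sg R).
Implicit Types (x : signs) (g : labels) (p : vpair n) (be : R).

(** The product over the two-element set needs no order of the endpoints; it is [1] when they lie on
    the same side of [x], and [-1] otherwise. *)
Definition parity x p : R := \prod_(u in val p) sg (x u).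

Lemma vpair_endpoints : {e : vpair n -> 'I_n * 'I_n | forall p,
  (e p).1 != (e p).2 /\ val p = [set (e p).1; (e p).2]%SET}.
Proof.
apply: cid; have /choice[e he] : forall p, exists uv : 'I_n * 'I_n,
    uv.1 != uv.2 /\ val p = [set uv.1; uv.2]%SET.
  by move=> p; have /cards2P[u [v [uv ->]]] := valP p; exists (u, v).
by exists e.
Qed.

Let e := sval vpair_endpoints.

Lemma parityE x p : parity x p = sg (x (e p).1) * sg (x (e p).2).
Proof.
have [ne pE] := svalP vpair_endpoints p.
by rewrite /parity pE big_setU1 ?finset.in_set1// big_set1.
Qed.

Lemma parity_sqr x p : parity x p * parity x p = 1.
Proof. by rewrite parityE mulrACA !sg_sqr mulr1. Qed.

Lemma parity_norm_le1 x p : -1 <= parity x p <= 1.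
Proof. by have := parity_sqr x p; nra. Qed.

(** Each coefficient is placed at the matrix entry [e p]. Since [e] is injective the squared norm is
    kept, and since endpoints differ the trace vanishes. *)
Lemma pair_chaos_mgf (b : vpair n -> R) : \sum_p b p ^+ 2 <= 1 / 256 ->
  mean (fun x => expR (\sum_p b p * parity x p)) <= expR (10 * \sum_p b p ^+ 2).
Proof.
pose A u v := \sum_(p | e p == (u, v)) b p.
have e_inj : injective e.
  move=> p p' pp'; apply: val_inj.
  have [_ ->] := svalP vpair_endpoints p; have [_ ->] := svalP vpair_endpoints p'.
  by rewrite -/e pp'.
have sumA (F : 'I_n -> 'I_n -> R) :
    \sum_u \sum_v A u v * F u v = \sum_p b p * F (e p).1 (e p).2.
  rewrite pair_big /= (partition_big e xpredT) //=; apply: eq_bigr => -[u v] _ /=.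
  by rewrite /A mulr_suml; apply: eq_bigr => p /eqP ->.
have Ae p : A (e p).1 (e p).2 = b p.
  rewrite /A (bigD1 p) -?surjective_pairing//= big1 ?addr0// => p' /andP[/eqP pp' ne].
  by move: ne; rewrite (e_inj _ _ pp') eqxx.
have normA : \sum_u \sum_v A u v ^+ 2 = \sum_p b p ^+ 2.
  under eq_bigr do under eq_bigr do rewrite expr2.
  by rewrite sumA; apply: eq_bigr => p _; rewrite Ae expr2.
have trA : \sum_u A u u = 0.
  apply: big1 => u _; apply: big1 => p /eqP epu.
  by have [] := svalP vpair_endpoints p; rewrite -/e epu eqxx.
rewrite -normA => b256; have := chaos_mgf b256; rewrite trA add0r.
apply: le_trans; apply: le_mean => x; rewrite sumA ler_expR.
by apply: ler_sum => p _; rewrite parityE.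
Qed.

(** Likelihood of [g] given [x]: independent signs with means [be * parity x p]; for [be = 0] it is
    uniform. *)
Definition label_weight be x g : R :=
  \prod_p ((1 + be * (parity x p * sg (g p))) / 2).

Definition planted_weight be (o : signs * labels) : R :=
  label_weight be o.1 o.2 / #|{: signs}|%:R.

Definition planted be (F : signs -> labels -> R) : R :=
  \sum_o planted_weight be o * F o.1 o.2.

Lemma plantedE be F :
  planted be F = mean (fun x => \sum_g label_weight be x g * F x g).
Proof.
rewrite /planted /mean mulr_suml.
rewrite -(pair_bigA _ (fun x g => label_weight be x g / #|{: signs}|%:R * F x g)).
by apply: eq_bigr => x _; rewrite mulr_suml; apply: eq_bigr => g _; rewrite mulrAC.
Qed.

Lemma label_weight_prod be x (f : vpair n -> bool -> R) :
  \sum_g label_weight be x g * \prod_p f p (g p) =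
  \prod_p ((1 + be * parity x p) / 2 * f p true
           + (1 - be * parity x p) / 2 * f p false).
Proof.
pose h p b := (1 + be * (parity x p * sg b)) / 2 * f p b.
rewrite (eq_bigr (fun g : labels => \prod_p h p (g p))); last first.
  by move=> g _; rewrite /label_weight -big_split.
rewrite -(bigA_distr_bigA h); apply: eq_bigr => p _.
by rewrite big_bool /h /sg mulr1 mulrN1 mulrN.
Qed.

Lemma label_weight_sum1 be x : \sum_g label_weight be x g = 1.
Proof.
rewrite (eq_bigr (fun g => label_weight be x g * \prod_(p : vpair n) 1)).
  by rewrite (label_weight_prod be x (fun _ _ => 1)) big1// => p _; field.
by move=> g _; rewrite big1 ?mulr1.
Qed.

Section Bias.
Variable be : R.
Hypothesis be01 : 0 <= be <= 1.

Lemma bias_parity x p : -1 <= be * parity x p <= 1.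
Proof.
have /andP[p0 p1] := parity_norm_le1 x p; have /andP[b0 b1] := be01.
by apply/andP; split; nra.
Qed.

Lemma label_weight_ge0 x g : 0 <= label_weight be x g.
Proof.
apply: prodr_ge0 => p _; have := bias_parity x p.
by case: (g p); rewrite /sg ?mulr1 ?mulrN1 ?mulrN; lra.
Qed.

Lemma planted_weight_ge0 o : 0 <= planted_weight be o.
Proof. by rewrite divr_ge0// label_weight_ge0. Qed.

Lemma planted_signs (F : signs -> R) : planted be (fun x _ => F x) = mean F.
Proof.
rewrite plantedE; apply: eq_mean => x.
by rewrite -mulr_suml label_weight_sum1 mul1r.
Qed.

Lemma planted_cst c : planted be (fun _ _ => c) = c.
Proof. by rewrite planted_signs mean_cst// card_signs_gt0. Qed.

Lemma le_planted F G : (forall x g, F x g <= G x g) -> planted be F <= planted be G.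
Proof. by move=> FG; apply: ler_sum => o _; rewrite ler_wpM2l// planted_weight_ge0. Qed.

Lemma label_noise_mgf x (a : vpair n -> R) :
  \sum_g label_weight be x g * expR (\sum_p a p * (sg (g p) - be * parity x p))
    <= expR (8 * \sum_p a p ^+ 2).
Proof.
pose f p b := expR (a p * (sg b - be * parity x p)).
rewrite (eq_bigr (fun g => label_weight be x g * \prod_p f p (g p))); last first.
  by move=> g _; rewrite expR_sum.
rewrite label_weight_prod mulr_sumr expR_sum; apply: ler_prod => p _.
have c1 := bias_parity x p; rewrite two_point_mgf// andbT.
by apply: addr_ge0; apply: mulr_ge0; rewrite ?expR_ge0//; lra.
Qed.

(* The noise of the labels and the planted signs are controlled separately, by
   the level-1 and the level-2 inequality. *)
Lemma label_information (w : signs * labels -> R) :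
  (forall o, 0 <= w o <= 1) ->
  let nu := \sum_o planted_weight be o * w o in
  0 < nu ->
  \sum_p (\sum_o planted_weight be o * w o * sg (o.2 p)) ^+ 2
    <= nu ^+ 2 * (64 * - ln nu + 512 * be ^+ 2 * (1 - ln nu) ^+ 2).
Proof.
move=> w01 nu nu0.
have l1 := @level1_inequality R _ _ w planted_weight_ge0 w01 nu0 (vpair n)
  (fun p o => sg (o.2 p) - be * parity o.1 p).
have l2 := @level2_inequality R _ _ w planted_weight_ge0 w01 nu0 (vpair n)
  (fun p o => parity o.1 p).
have {}l1 := l1 _; have {}l2 := l2 _.
apply: (@le_trans _ _ (\sum_p (2 * (\sum_o planted_weight be o * w o *
     (sg (o.2 p) - be * parity o.1 p)) ^+ 2
   + 2 * be ^+ 2 * (\sum_o planted_weight be o * w o * parity o.1 p) ^+ 2))).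
  apply: ler_sum => p _; set a := (X in X ^+ 2 <= _).
  set b := (X in _ <= 2 * X ^+ 2 + _); set c := (X in _ <= _ + _ * X ^+ 2).
  have -> : a = b + be * c.
    rewrite /a /b /c mulr_sumr -big_split; apply: eq_bigr => o _ /=; ring.
  by have := sqr_ge0 (b - be * c); nra.
rewrite big_split -!mulr_sumr /=.
have h1 : \sum_p (\sum_o planted_weight be o * w o *
     (sg (o.2 p) - be * parity o.1 p)) ^+ 2 <= 32 * nu ^+ 2 * - ln nu.
  apply: l1 => a.
  have := plantedE be (fun x g => expR (\sum_p a p * (sg (g p) - be * parity x p))).
  rewrite /planted => ->; rewrite -[leRHS](mean_cst _ (@card_signs_gt0 'I_n)).
  by apply: le_mean => x; exact: label_noise_mgf.
have h2 : \sum_p (\sum_o planted_weight be o * w o * parity o.1 p) ^+ 2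
    <= 256 * nu ^+ 2 * (1 - ln nu) ^+ 2.
  apply: l2 => a a256.
  have := planted_signs (fun x => expR (\sum_p a p * parity x p)).
  by rewrite /planted => ->; exact: pair_chaos_mgf.
have := ler_wpM2l (_ : 0 <= 2 * be ^+ 2) h2; rewrite mulr_ge0 ?sqr_ge0//.
move=> /(_ isT); lra.
Qed.

End Bias.
End PlantedLaw.

(** * Averages over sequences of independent queries *)

Section QuerySequences.
Variables (R : realType) (P : finType).
Implicit Types (k : nat) (F G : seq P -> R).

Fixpoint qmean k F : R :=
  if k is k'.+1 then mean (fun p => qmean k' (fun ps => F (p :: ps)))
  else F [::].

Lemma qmean_tuple k F : mean (fun ps : k.-tuple P => F ps) = qmean k F.
Proof.
elim: k F => [|k IH] F /=.
  rewrite /mean card_tuple expn0 divr1 (bigD1 [tuple])//= big1 ?addr0// => ps.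
  by rewrite tuple0 => /eqP.
under [RHS]eq_mean do rewrite -IH.
rewrite /mean !card_tuple -[in RHS]mulr_suml -mulrA -invfM -natrM -expnSr.
congr (_ / _).
rewrite (pair_bigA _ (fun p (ps : k.-tuple P) => F (p :: ps))) /=.
rewrite (reindex (fun u : P * k.-tuple P => [tuple of u.1 :: u.2])) //=.
exists (fun t : k.+1.-tuple P => (thead t, [tuple of behead t])) => [[p ps]|t] _ /=.
  by rewrite theadE; congr pair; apply: val_inj.
by rewrite -tuple_eta.
Qed.

Lemma le_qmean k F G : (forall ps, size ps = k -> F ps <= G ps) ->
  qmean k F <= qmean k G.
Proof.
elim: k F G => [|k IH] F G FG /=; first exact: FG.
by apply: le_mean => p; apply: IH => ps psk; apply: FG; rewrite /= psk.
Qed.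

Lemma eq_qmean k F G : (forall ps, size ps = k -> F ps = G ps) ->
  qmean k F = qmean k G.
Proof.
by move=> FG; apply/eqP; rewrite eq_le !le_qmean// => ps psk; rewrite FG.
Qed.

Lemma qmean_rcons k F :
  qmean k.+1 F = qmean k (fun ps => mean (fun p => F (rcons ps p))).
Proof.
elim: k F => [//|k IH] F.
have -> : qmean k.+2 F = mean (fun p => qmean k.+1 (fun ps => F (p :: ps))) by [].
by apply: eq_mean => p; rewrite IH.
Qed.

Lemma qmean_lin (I : finType) (c : I -> R) (F : I -> seq P -> R) k :
  qmean k (fun ps => \sum_i c i * F i ps) = \sum_i c i * qmean k (F i).
Proof.
elim: k F => [//|k IH] F /=; under eq_mean do rewrite IH.
by rewrite mean_sum; apply: eq_bigr => i _; rewrite meanZ.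
Qed.

Lemma qmeanZ c F k : qmean k (fun ps => c * F ps) = c * qmean k F.
Proof.
have := @qmean_lin unit (fun=> c) (fun=> F) k; rewrite big_const card_unit /= addr0 => <-.
by apply: eq_qmean => ps _; rewrite big_const card_unit /= addr0.
Qed.

Lemma qmeanD F G k : qmean k (fun ps => F ps + G ps) = qmean k F + qmean k G.
Proof.
have := @qmean_lin bool (fun=> 1) (fun b => if b then F else G) k.
rewrite big_bool /= !mul1r => <-; apply: eq_qmean => ps _.
by rewrite big_bool /= !mul1r.
Qed.

Lemma qmean_cst c k : (0 < #|P|)%N -> qmean k (fun=> c) = c.
Proof. by move=> P0; elim: k => [//|k IH] /=; rewrite IH mean_cst. Qed.

Lemma qmean_prod (f : P -> R) k :
  qmean k (fun ps => \prod_(p <- ps) f p) = mean f ^+ k.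
Proof.
elim: k => [|k IH] /=; first by rewrite big_nil.
rewrite (eq_mean (G := fun p => mean f ^+ k * f p)) ?meanZ ?exprSr// => p.
rewrite -IH mulrC -qmeanZ; apply: eq_qmean => ps _; exact: big_cons.
Qed.

End QuerySequences.

(** * Bounded memory: comparison with fresh coins *)

Section BoundedMemory.
Variables (R : realType) (n : nat) (St : finType).
Variables (st : nat -> St -> vpair n -> bool -> St) (m0 : St).
Hypothesis pairs_gt0 : (0 < #|{: vpair n}|)%N.
Local Notation signs := {ffun 'I_n -> bool}.
Local Notation labels := {ffun vpair n -> bool}.
Implicit Types (g : labels) (m : St) (ps : seq (vpair n)).

Fixpoint memory g t m ps : St :=
  if ps is p :: ps' then memory g t.+1 (st t m p (g p)) ps' else m.

Lemma memory_rcons g t m ps p :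
  memory g t m (rcons ps p) = st (t + size ps) (memory g t m ps) p (g p).
Proof.
by elim: ps t m => [|p' ps IH] t m /=; rewrite ?addn0// IH addSnnS.
Qed.

(** Whereas [memory] answers a repeated pair consistently from [g], every answer here is a new fair
    coin. [k] counts the queries to come, [t] those made. *)
Fixpoint coin_value (F : St -> R) k t m : R :=
  if k is k'.+1 then
    mean (fun p => (coin_value F k' t.+1 (st t m p true)
                    + coin_value F k' t.+1 (st t m p false)) / 2)
  else F m.

Lemma coin_value01 F k t m : (forall m, 0 <= F m <= 1) ->
  0 <= coin_value F k t m <= 1.
Proof.
move=> F01; elim: k t m => [//|k IH] t m /=; apply/andP; split.
  by apply: mean_ge0 => p; have := IH t.+1 (st t m p true);
    have := IH t.+1 (st t m p false); lra.
rewrite -[leRHS](mean_cst _ pairs_gt0); apply: le_mean => p.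
by have := IH t.+1 (st t m p true); have := IH t.+1 (st t m p false); lra.
Qed.

Lemma coin_value_compl F k t m :
  coin_value (fun m => 1 - F m) k t m = 1 - coin_value F k t m.
Proof.
elim: k t m => [//|k IH] t m /=.
rewrite -[X in X - _](mean_cst _ pairs_gt0) -mulN1r -meanZ -meanD.
by apply: eq_mean => p; rewrite !IH; field.
Qed.

(** The bound of [label_information] averaged over memory states, with the two entropy estimates for
    their law inserted. *)
Definition information_bound (be : R) : R :=
  64 * (ln #|St|%:R + 1) + 512 * be ^+ 2 * (4 * ln #|St|%:R ^+ 2 + 18).

Section Potential.
Variables (be th : R) (F : St -> R).
Hypothesis be01 : 0 <= be <= 1.
Hypothesis th01 : 0 < th <= 1.
Hypothesis F01 : forall m, 0 <= F m <= 1.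

Let Phi (v : R) := v - th * v ^+ 2.

(** Plays the role of [w] in [label_information]: conditioning on a memory state reweights the
    labels. *)
Let hit t m g : R := qmean t (fun ps => (memory g 0 m0 ps == m)%:R).

Let hit01 t m g : 0 <= hit t m g <= 1.
Proof.
apply/andP; split.
  by rewrite -(qmean_cst 0 t pairs_gt0); apply: le_qmean => ps _; rewrite ler0n.
rewrite -[leRHS](qmean_cst 1 t pairs_gt0); apply: le_qmean => ps _.
by rewrite lern1; case: eqP.
Qed.

Let qmean_hit t g (h : St -> R) :
  qmean t (fun ps => h (memory g 0 m0 ps)) = \sum_m h m * hit t m g.
Proof.
rewrite /hit -qmean_lin; apply: eq_qmean => ps _.
rewrite (bigD1 (memory g 0 m0 ps)) //= eqxx mulr1 big1 ?addr0// => m.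
by rewrite eq_sym => /negbTE ->; rewrite mulr0.
Qed.

Let weight := @planted_weight R n be.
Let nu t m := \sum_o weight o * hit t m o.2.
Let corr t m p := \sum_o weight o * hit t m o.2 * sg R (o.2 p).

Let nu_ge0 t m : 0 <= nu t m.
Proof.
apply: sumr_ge0 => o _; have /andP[h0 _] := hit01 t m o.2.
by apply: mulr_ge0 => //; exact: planted_weight_ge0.
Qed.

Let nu_sum1 t : \sum_m nu t m = 1.
Proof.
rewrite exchange_big /= -[RHS](planted_cst n be _); apply: eq_bigr => o _.
rewrite -mulr_sumr -/weight; congr (_ * _).
rewrite -[RHS](qmean_cst 1 t pairs_gt0).
by have := qmean_hit t o.2 (fun=> 1) => ->; apply: eq_bigr => m _; rewrite mul1r.
Qed.

Let corr0 t m p : nu t m = 0 -> corr t m p = 0.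
Proof.
move=> nu0; apply: big1 => o _.
suff -> : weight o * hit t m o.2 = 0 by rewrite mul0r.
apply: (psumr_eq0P _ nu0) => // o' _; have /andP[h0 _] := hit01 t m o'.2.
by apply: mulr_ge0 => //; exact: planted_weight_ge0.
Qed.

Let potential k t : R :=
  planted be (fun _ g => qmean t (fun ps => Phi (coin_value F k t (memory g 0 m0 ps)))).

Let potentialE k t : potential k t = \sum_m nu t m * Phi (coin_value F k t m).
Proof.
rewrite /potential /planted.
under eq_bigr do rewrite (qmean_hit t _ (fun m => Phi (coin_value F k t m))) mulr_sumr.
rewrite exchange_big; apply: eq_bigr => m _; rewrite /nu mulr_suml.
by apply: eq_bigr => o _; rewrite mulrCA mulrC.
Qed.

Let even k t m p :=
  (Phi (coin_value F k t.+1 (st t m p true))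
   + Phi (coin_value F k t.+1 (st t m p false))) / 2.
Let odd k t m p :=
  (Phi (coin_value F k t.+1 (st t m p true))
   - Phi (coin_value F k t.+1 (st t m p false))) / 2.

(** The new value splits into an even part in the sign of the answer, weighted by [nu], and an odd
    part, weighted by the correlation [corr] of label and state. *)
Let potentialS k t : potential k t.+1 =
  \sum_m mean (fun p => nu t m * even k t m p + corr t m p * odd k t m p).
Proof.
rewrite /potential /planted.
transitivity (\sum_o weight o * \sum_m
    mean (fun p => even k t m p + sg R (o.2 p) * odd k t m p) * hit t m o.2).
  apply: eq_bigr => o _; congr (_ * _); rewrite qmean_rcons.
  rewrite -(qmean_hit t o.2 (fun m =>
    mean (fun p => even k t m p + sg R (o.2 p) * odd k t m p))).
  apply: eq_qmean => ps pst; apply: eq_mean => p.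
  rewrite memory_rcons add0n pst /even /odd.
  by case: (o.2 p); rewrite /sg; field.
under eq_bigr do rewrite mulr_sumr.
rewrite exchange_big; apply: eq_bigr => m _.
under eq_bigr do rewrite mulrCA mulrC -meanZ.
rewrite -mean_sum; apply: eq_mean => p.
rewrite /nu /corr !mulr_suml -big_split; apply: eq_bigr => o _ /=; ring.
Qed.

(* Strict concavity of [Phi] absorbs the drift: a bias [a] of the next answer
   raises the potential by at most [a^2 / (4 th)]. *)
Let potential_step k t : potential k t.+1 <=
  potential k.+1 t + information_bound be / (4 * th * #|{: vpair n}|%:R).
Proof.
have /andP[th0 th1] := th01.
have N0 : (0 : R) < #|{: vpair n}|%:R by rewrite ltr0n.
pose err m := nu t m * (64 * - ln (nu t m)
  + 512 * be ^+ 2 * (1 - ln (nu t m)) ^+ 2) / (4 * th * #|{: vpair n}|%:R).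
apply: (@le_trans _ _ (\sum_m (nu t m * Phi (coin_value F k.+1 t m) + err m))).
  rewrite potentialS; apply: ler_sum => m _.
  have := nu_ge0 t m; rewrite le_eqVlt => /orP[/eqP nu0|nu_gt0].
    (* An unreachable state has no correlation, and the factor [nu t m] annuls the default value of
       [ln 0] in [err]. *)
    rewrite /err -nu0 !mul0r add0r (eq_mean (G := fun=> 0)) ?mean_cst// => p.
    by rewrite corr0// !mul0r addr0.
  have nu_neq0 : nu t m != 0 by rewrite gt_eqF.
  set V := coin_value F k.+1 t m.
  pose v p b := coin_value F k t.+1 (st t m p b).
  have VE : V = mean (fun p => (v p true + v p false) / 2) by [].
  (* The first two terms are [nu t m] times the tangent to [Phi] at [V]; their mean over [p] is
     exactly [nu t m * Phi V]. *)
  apply: (@le_trans _ _ (mean (fun p =>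
     (nu t m * (1 - 2 * th * V) * ((v p true + v p false) / 2)
      + nu t m * th * V ^+ 2)
     + (4 * th * nu t m)^-1 * corr t m p ^+ 2))).
    apply: le_mean => p; rewrite /even /odd -/(v p true) -/(v p false).
    have := coin_value01 k t.+1 (st t m p true) F01.
    have := coin_value01 k t.+1 (st t m p false) F01.
    rewrite -/(v p true) -/(v p false).
    move: (v p true) (v p false) (corr t m p) => a b c /andP[b0 b1] /andP[a0 a1].
    pose B := (Phi a - Phi b) / 2.
    (* The weight makes the term in [B ^+ 2] at most [nu t m * th * (a - b) ^+ 2 / 4], just what the
       concavity of [Phi] loses between [a] and [b]. *)
    have amgm : c * B <= nu t m * th * B ^+ 2 + (4 * th * nu t m)^-1 * c ^+ 2.
      rewrite -subr_ge0.
      have -> : nu t m * th * B ^+ 2 + (4 * th * nu t m)^-1 * c ^+ 2 - c * B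
          = (2 * th * nu t m * B - c) ^+ 2 / (4 * th * nu t m).
        by field; rewrite nu_neq0 gt_eqF.
      by rewrite divr_ge0 ?sqr_ge0// mulr_ge0 ?mulr_ge0// ltW.
    (* [Phi] is 1-Lipschitz on the unit interval because [th <= 1]. *)
    have B_le : B ^+ 2 <= (a - b) ^+ 2 / 4.
      have -> : B = (a - b) / 2 * (1 - th * (a + b)) by rewrite /B /Phi; field.
      rewrite exprMn; have -> : ((a - b) / 2) ^+ 2 = (a - b) ^+ 2 / 4 by field.
      rewrite ler_piMr ?divr_ge0 ?sqr_ge0//.
      have t0 : 0 <= th * (a + b) by rewrite mulr_ge0 ?addr_ge0// ltW.
      have t2 : th * (a + b) <= 2.
        apply: le_trans (ler_wpM2r _ th1) _; first by rewrite addr_ge0.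
        by rewrite mul1r; lra.
      by rewrite expr2; nra.
    have nth : 0 <= nu t m * th by rewrite mulr_ge0 ?ltW.
    apply: le_trans (lerD (lexx _) amgm) _; rewrite addrA lerD2r.
    apply: le_trans (lerD (lexx _) (ler_wpM2l nth B_le)) _.
    rewrite -subr_ge0 /Phi.
    have -> : nu t m * (1 - 2 * th * V) * ((a + b) / 2) + nu t m * th * V ^+ 2 -
      (nu t m * ((a - th * a ^+ 2 + (b - th * b ^+ 2)) / 2) +
       nu t m * th * ((a - b) ^+ 2 / 4))
      = nu t m * th * ((a + b) / 2 - V) ^+ 2 by field.
    by rewrite mulr_ge0 ?sqr_ge0.
  rewrite !meanD !meanZ mean_cst// -VE /Phi.
  have -> : nu t m * (1 - 2 * th * V) * V + nu t m * th * V ^+ 2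
     = nu t m * (V - th * V ^+ 2) by ring.
  rewrite lerD2l /err /mean.
  have info := label_information be01 (fun o => hit01 t m o.2) nu_gt0.
  apply: le_trans (ler_wpM2l _ (ler_wpM2r _ info)) _.
  - by rewrite invr_ge0 mulr_ge0 ?mulr_ge0// ltW.
  - by rewrite invr_ge0 ltW.
  rewrite -/weight -/(nu t m) le_eqVlt; apply/orP; left; apply/eqP.
  by field; rewrite nu_neq0 !gt_eqF.
rewrite big_split -potentialE lerD2l /err -mulr_suml ler_wpM2r//.
  by rewrite invr_ge0 mulr_ge0 ?mulr_ge0// ltW.
have e1 := entropy_le (nu_ge0 t) (nu_sum1 t).
have e2 := sqr_entropy_le (nu_ge0 t) (nu_sum1 t).
rewrite /information_bound.
have -> : \sum_m nu t m * (64 * - ln (nu t m) + 512 * be ^+ 2 * (1 - ln (nu t m)) ^+ 2)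
   = 64 * (\sum_m nu t m * - ln (nu t m))
     + 512 * be ^+ 2 * \sum_m nu t m * (1 - ln (nu t m)) ^+ 2.
  by rewrite !mulr_sumr -big_split; apply: eq_bigr => m _ /=; ring.
have c1 : 0 <= (64 : R) by lra.
have c2 : 0 <= 512 * be ^+ 2 by have := sqr_ge0 be; lra.
exact: lerD (ler_wpM2l c1 e1) (ler_wpM2l c2 e2).
Qed.

(** Telescopes [potential_step]. Initially the potential is at most the coin value; at the end it is
    within [th] of the acceptance probability, as [Phi v >= v - th] on the unit interval. *)
Lemma bounded_memory_coin k :
  planted be (fun _ g => qmean k (fun ps => F (memory g 0 m0 ps))) <=
  coin_value F k 0 m0 + th
  + k%:R * (information_bound be / (4 * th * #|{: vpair n}|%:R)).
Proof.
have /andP[th0 th1] := th01.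
set err := information_bound be / _.
have pot j t : potential j t <= potential (t + j) 0 + t%:R * err.
  elim: t j => [|t IH] j; first by rewrite mul0r addr0.
  apply: le_trans (potential_step j t) _; rewrite -/err.
  by have := IH j.+1; rewrite addnS addSn -natr1 mulrDl mul1r; lra.
have pot0 : potential k 0 <= coin_value F k 0 m0.
  rewrite /potential /= planted_cst /Phi gerBl mulr_ge0 ?sqr_ge0//; exact: ltW.
have potk : planted be (fun _ g => qmean k (fun ps => F (memory g 0 m0 ps))) - th
    <= potential 0 k.
  rewrite -[X in _ - X](planted_cst n be _) /planted -sumrB; apply: ler_sum => o _.
  rewrite -mulrBr ler_wpM2l ?planted_weight_ge0//.
  rewrite -[X in _ - X](qmean_cst th k pairs_gt0) -mulN1r -qmeanZ -qmeanD.
  apply: le_qmean => ps _ /=; rewrite mulN1r /Phi lerD2l lerN2.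
  rewrite ler_piMr//; first exact: ltW.
  by have /andP[f0 f1] := F01 (memory o.2 0 m0 ps); rewrite expr_le1.
by have := pot 0 k; rewrite addn0; lra.
Qed.

End Potential.

(** Both laws are compared with the same coin value, through [F] under [be] and through [1 - F]
    under the null law. The null law also differs from fresh coins, since repeated pairs get
    repeated answers. *)
Lemma bounded_memory_indistinguishable (be th : R) (F : St -> R) k :
    0 <= be <= 1 -> 0 < th <= 1 -> (forall m, 0 <= F m <= 1) ->
  planted be (fun _ g => qmean k (fun ps => F (memory g 0 m0 ps)))
  - planted 0 (fun _ g => qmean k (fun ps => F (memory g 0 m0 ps))) <=
  2 * (th + k%:R * (information_bound be / (4 * th * #|{: vpair n}|%:R))).
Proof.
move=> be01 th01 F01; have z01 : 0 <= (0 : R) <= 1 by rewrite lexx ler01.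
have h1 := bounded_memory_coin be01 th01 F01 k.
have h0 := @bounded_memory_coin 0 th (fun m => 1 - F m) z01 th01 _ k.
have {}h0 := h0 (fun m => _); move: h0; rewrite coin_value_compl => h0.
have F'01 m : 0 <= 1 - F m <= 1 by have := F01 m; lra.
have {}h0 := h0 F'01; move: h0.
have -> : planted 0 (fun _ g => qmean k (fun ps => 1 - F (memory g 0 m0 ps)))
    = 1 - planted 0 (fun _ g => qmean k (fun ps => F (memory g 0 m0 ps))).
  rewrite -[X in X - _](planted_cst n 0 _) /planted -sumrB; apply: eq_bigr => o _.
  rewrite -mulrBr; congr (_ * _).
  rewrite -[X in _ = X - _](qmean_cst 1 k pairs_gt0) -mulN1r -qmeanZ -qmeanD.
  by apply: eq_qmean => ps _; rewrite mulN1r.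
have : information_bound 0 / (4 * th * #|{: vpair n}|%:R)
    <= information_bound be / (4 * th * #|{: vpair n}|%:R).
  rewrite ler_wpM2r ?invr_ge0 ?mulr_ge0//; first by case/andP: th01 => /ltW.
  rewrite lerD2l expr0n mulr0 mul0r; apply: mulr_ge0.
    by have := sqr_ge0 be; lra.
  by have := sqr_ge0 (ln #|St|%:R : R); lra.
move=> mono; have := ler_wpM2l (ler0n R k) mono; lra.
Qed.

End BoundedMemory.

(** * Arbitrary memory: the chi-square method *)

Section UnboundedMemory.
Variables (R : realType) (n : nat).
Local Notation signs := {ffun 'I_n -> bool}.
Local Notation labels := {ffun vpair n -> bool}.
Local Notation sg := (sg R).
Local Notation parity := (@parity R n).
Implicit Types (x y : signs) (g : labels) (p : vpair n) (be t : R).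
Implicit Types (ps s : seq (vpair n)).

Definition ignores (D : labels -> R) p := forall g, D (flip p g) = D g.

(** Uniform labels at distinct pairs are independent, so those in [s] are averaged out one at a
    time. *)
Lemma mean_label_prod s (f : vpair n -> bool -> R) (D : labels -> R) :
  uniq s -> (forall p, p \in s -> ignores D p) ->
  mean (fun g => \prod_(p <- s) f p (g p) * D g)
    = \prod_(p <- s) ((f p true + f p false) / 2) * mean D.
Proof.
elim: s => [_ _|p s IH /= /andP[ps us] Ds].
  by rewrite big_nil mul1r; apply: eq_mean => g; rewrite big_nil mul1r.
rewrite big_cons -mulrA -IH// => [|p' p's]; last by apply: Ds; rewrite inE p's orbT.
rewrite -meanZ [LHS](mean_flip p); apply: eq_mean => g /=.
have -> : \prod_(p' <- p :: s) f p' (flip p g p')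
    = f p (~~ g p) * \prod_(p' <- s) f p' (g p').
  rewrite big_cons ffunE eqxx; congr (_ * _).
  apply: eq_big_seq => p' p's; rewrite ffunE; case: eqP => // p'p.
  by move: ps; rewrite -p'p p's.
by rewrite Ds ?mem_head// big_cons; case: (g p) => /=; field.
Qed.

(** Boolean equality multiplies signs, so [xors x] is a translation of the group of sign vectors. *)
Definition xors x y : signs := [ffun u => x u == y u].

Lemma xors_inj x : injective (xors x).
Proof.
move=> y y' /ffunP h; apply/ffunP => u; have := h u; rewrite !ffunE.
by case: (x u) (y u) (y' u) => [] [] [].
Qed.

Lemma parity_xors x y p : parity (xors x y) p = parity x p * parity y p.
Proof.
rewrite /parity -big_split; apply: eq_bigr => u _; rewrite ffunE /sg.
by case: (x u) (y u) => [] [] /=; rewrite ?mulr1 ?mul1r ?mulrNN ?mulr1.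
Qed.

(** Products of parities are characters of the sign group; the Fourier coefficients of [F] at them
    are required to be nonnegative. *)
Definition nonneg_spectrum (F : signs -> R) := forall s,
  0 <= mean (fun x => F x * \prod_(p <- s) parity x p).

(* The mean of a character equals its own square. *)
Lemma nonneg_spectrum1 : nonneg_spectrum (fun=> 1).
Proof.
move=> s; set h := fun x => _.
have hM x y : h (xors x y) = h x * h y.
  by rewrite /h !mul1r -big_split; apply: eq_bigr => p _; exact: parity_xors.
suff -> : mean h = mean h ^+ 2 by exact: sqr_ge0.
transitivity (mean (fun x : signs => mean h)).
  by rewrite mean_cst ?card_signs_gt0.
rewrite expr2 -meanZ; apply: eq_mean => x.
rewrite -[LHS](mean_inj h (@xors_inj x)) mulrC -meanZ; apply: eq_mean => y.
exact: hM.
Qed.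

Lemma nonneg_spectrumD F G : nonneg_spectrum F -> nonneg_spectrum G ->
  nonneg_spectrum (fun x => F x + G x).
Proof.
move=> hF hG s; apply: le_trans (addr_ge0 (hF s) (hG s)) _.
by rewrite -meanD; apply: le_mean => x; rewrite mulrDl.
Qed.

Lemma nonneg_spectrum_parity F t p : 0 <= t -> nonneg_spectrum F ->
  nonneg_spectrum (fun x => t * parity x p * F x).
Proof.
move=> t0 hF s; apply: le_trans (mulr_ge0 t0 (hF (p :: s))) _.
by rewrite -meanZ; apply: le_mean => x; rewrite big_cons; apply: eq_ler; ring.
Qed.

Lemma eq_nonneg_spectrum F G : F =1 G -> nonneg_spectrum F -> nonneg_spectrum G.
Proof. by move=> FG hF s; under eq_mean do rewrite -FG; exact: hF. Qed.

(** A repetition adds a term [t * parity x p] times a product with nonnegative spectrum. The lemma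
    passes from distinct pairs, which carry the likelihood ratio, to all queries, which are
    independent. *)
Lemma mean_undup_le t ps : 0 <= t ->
  mean (fun x => \prod_(p <- undup ps) (1 + t * parity x p))
    <= mean (fun x => \prod_(p <- ps) (1 + t * parity x p)).
Proof.
move=> t0; set A := fun s x => \prod_(p <- s) (1 + t * parity x p).
have hA s : nonneg_spectrum (A s).
  elim: s => [|p s IH].
    by apply: eq_nonneg_spectrum nonneg_spectrum1 => x; rewrite /A big_nil.
  apply: eq_nonneg_spectrum (nonneg_spectrumD IH (nonneg_spectrum_parity p t0 IH)) => x.
  by rewrite /A big_cons mulrDl mul1r.
(* The induction needs all coefficients, since multiplying by a parity shifts them. *)
suff : nonneg_spectrum (fun x => A ps x - A (undup ps) x).
  move=> /(_ [::]) h; rewrite -subr_ge0; apply: le_trans h _.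
  rewrite -mulN1r -meanZ -meanD; apply: le_mean => x.
  by rewrite big_nil mulr1 mulN1r.
elim: ps => [|p ps IH].
  move=> s; rewrite (eq_mean (G := fun=> 0)) ?mean_cst ?card_signs_gt0// => x.
  by rewrite subrr mul0r.
rewrite /=; case: ifP => pps.
  apply: eq_nonneg_spectrum (nonneg_spectrumD IH (nonneg_spectrum_parity p t0 (hA ps))) => x.
  by rewrite /A big_cons; ring.
apply: eq_nonneg_spectrum (nonneg_spectrumD IH (nonneg_spectrum_parity p t0 IH)) => x.
by rewrite /A !big_cons; ring.
Qed.

Let ratio be x s g := \prod_(p <- s) (1 + be * (parity x p * sg (g p))).

Lemma label_weightE be x g :
  label_weight be x g = ratio be x (enum {: vpair n}) g / #|{: labels}|%:R.
Proof.
rewrite /label_weight /ratio big_enum /= big_split /=; congr (_ * _).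
by rewrite prodr_const card_ffun card_bool natrX exprVn.
Qed.

(** Labels of unqueried pairs average out to [1]; [undup] counts the label of a repeated pair
    once. *)
Lemma planted_local be ps (D : labels -> R) :
  (forall p, p \notin ps -> ignores D p) ->
  planted be (fun _ g => D g)
    = mean (fun g => mean (fun x => ratio be x (undup ps) g) * D g).
Proof.
move=> Dps; rewrite plantedE.
under [RHS]eq_mean do rewrite mulrC -meanZ.
rewrite mean_mean; apply: eq_mean => x.
pose s := [seq p <- enum {: vpair n} | p \notin ps].
have us : uniq s by rewrite filter_uniq ?enum_uniq.
have -> : \sum_g label_weight be x g * D g = mean (fun g =>
    ratio be x s g * (ratio be x (undup ps) g * D g)).
  rewrite /mean mulr_suml; apply: eq_bigr => g _.
  rewrite label_weightE mulrAC; congr (_ / _); rewrite mulrA; congr (_ * _).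
  rewrite {1}/ratio (bigID (fun p => p \notin ps)) /= -big_filter; congr (_ * _).
  rewrite -big_filter; apply: perm_big; apply: uniq_perm.
  - by rewrite filter_uniq ?enum_uniq.
  - exact: undup_uniq.
  - by move=> p; rewrite mem_filter negbK mem_undup mem_enum andbT.
rewrite (mean_label_prod (fun p b => 1 + be * (parity x p * sg b))) //.
  rewrite big1 ?mul1r => [|p _]; last by rewrite /sg; field.
  by apply: eq_mean => g; rewrite mulrC.
move=> p; rewrite mem_filter => /andP[pps _] g; rewrite Dps//; congr (_ * _).
apply: eq_big_seq => p'; rewrite mem_undup => p'ps; rewrite ffunE.
by case: eqP => // p'p; move: pps; rewrite -p'p p'ps.
Qed.

(** The square is a mean over two independent sign vectors. Averaging the labels leaves the products
    of their parities, which [xors] turns into the parities of one uniform vector. *)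
Lemma mean_ratio_sqr be s : uniq s ->
  mean (fun g => mean (fun x => ratio be x s g) ^+ 2)
    = mean (fun x => \prod_(p <- s) (1 + be ^+ 2 * parity x p)).
Proof.
move=> us.
have -> : mean (fun g => mean (fun x => ratio be x s g) ^+ 2) =
    mean (fun g => mean (fun x => mean (fun y => ratio be x s g * ratio be y s g))).
  apply: eq_mean => g; rewrite expr2 -meanZ; apply: eq_mean => x.
  by rewrite mulrC -meanZ.
rewrite mean_mean -[RHS](mean_cst _ (@card_signs_gt0 'I_n)); apply: eq_mean => x.
rewrite mean_mean -[RHS](mean_inj _ (@xors_inj x)); apply: eq_mean => y /=.
pose f p b := (1 + be * (parity x p * sg b)) * (1 + be * (parity y p * sg b)).
rewrite (eq_mean (G := fun g => \prod_(p <- s) f p (g p) * 1)); last first.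
  by move=> g; rewrite mulr1 /ratio -big_split.
rewrite mean_label_prod// mean_cst ?card_signs_gt0// mulr1.
by apply: eq_bigr => p _; rewrite parity_xors /f /sg; field.
Qed.

Lemma mean_ratio be s : uniq s -> mean (fun g => mean (fun x => ratio be x s g)) = 1.
Proof.
move=> us; rewrite mean_mean -[RHS](mean_cst _ (@card_signs_gt0 'I_n)).
apply: eq_mean => x.
pose f p b := 1 + be * (parity x p * sg b).
rewrite (eq_mean (G := fun g => \prod_(p <- s) f p (g p) * 1)); last first.
  by move=> g; rewrite mulr1.
rewrite mean_label_prod// mean_cst ?card_signs_gt0// mulr1 big1// => p _.
by rewrite /f /sg; field.
Qed.

(** Young's inequality [(L - 1) * D <= th * D ^+ 2 + (L - 1) ^+ 2 / (4 * th)] for the averaged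
    likelihood ratio [L], whose mean is [1]. *)
Lemma planted_local_indistinguishable be th ps (D : labels -> R) :
    0 < th -> (forall g, 0 <= D g <= 1) ->
    (forall p, p \notin ps -> ignores D p) ->
  planted be (fun _ g => D g) - planted 0 (fun _ g => D g)
    <= th + (mean (fun x => \prod_(p <- ps) (1 + be ^+ 2 * parity x p)) - 1) / (4 * th).
Proof.
move=> th0 D01 Dps; rewrite !(planted_local _ Dps).
set L := fun g => mean (fun x => ratio be x (undup ps) g).
have -> : mean (fun g => mean (fun x => ratio 0 x (undup ps) g) * D g) = mean D.
  apply: eq_mean => g; rewrite (eq_mean (G := fun=> 1)) ?mean_cst ?card_signs_gt0 ?mul1r//.
  by move=> x; rewrite /ratio big1// => p _; rewrite mul0r addr0.
apply: (@le_trans _ _ (th + (mean (fun g => L g ^+ 2) - 1) / (4 * th))); last first.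
  have k0 : 0 <= (4 * th)^-1 by rewrite invr_ge0 mulr_ge0// ltW.
  rewrite lerD2l ler_wpM2r// lerD2r mean_ratio_sqr ?undup_uniq//.
  by rewrite mean_undup_le// sqr_ge0.
have th_neq0 : th != 0 by rewrite gt_eqF.
apply: (@le_trans _ _ (mean (fun g => (4 * th)^-1 * L g ^+ 2
     + (- (2 * th)^-1 * L g + (th + (4 * th)^-1))))).
  rewrite -mulN1r -meanZ -meanD; apply: le_mean => g.
  have /andP[d0 d1] := D01 g; rewrite -subr_ge0.
  have -> : (4 * th)^-1 * L g ^+ 2 + (- (2 * th)^-1 * L g + (th + (4 * th)^-1))
      - (L g * D g + -1 * D g)
    = (L g - 1 - 2 * th * D g) ^+ 2 / (4 * th) + th * (1 - D g ^+ 2) by field.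
  have th4 : 0 <= 4 * th by lra.
  rewrite addr_ge0 ?divr_ge0 ?sqr_ge0// mulr_ge0 ?(ltW th0)//.
  by rewrite subr_ge0 expr_le1.
rewrite !meanD !meanZ !mean_cst ?card_signs_gt0// mean_ratio ?undup_uniq//.
by apply: eq_ler; field.
Qed.

(** Averaging over the queries turns the product into a [q]-th power, at most
    [exp (q * be ^+ 2 * mean (parity x))]: a chaos with equal coefficients on all pairs. *)
Lemma queries_indistinguishable be th (D : labels -> seq (vpair n) -> R) q :
    (0 < #|{: vpair n}|)%N -> 0 <= be <= 1 -> 0 < th ->
    (forall g ps, 0 <= D g ps <= 1) ->
    (forall ps p, p \notin ps -> ignores (D ^~ ps) p) ->
    (q%:R * be ^+ 2) ^+ 2 / #|{: vpair n}|%:R <= 1 / 256 ->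
  planted be (fun _ g => qmean q (D g)) - planted 0 (fun _ g => qmean q (D g))
    <= th + (expR (10 * ((q%:R * be ^+ 2) ^+ 2 / #|{: vpair n}|%:R)) - 1) / (4 * th).
Proof.
move=> N0 /andP[b0 b1] th0 D01 Dps small.
have exch b : planted b (fun _ g => qmean q (D g))
    = qmean q (fun ps => planted b (fun _ g => D g ps)).
  by rewrite /planted qmean_lin.
have NR0 : (#|{: vpair n}|%:R : R) != 0 by rewrite pnatr_eq0 -lt0n.
rewrite !exch -[X in _ + X <= _]mulN1r -qmeanZ -qmeanD.
pose M ps := mean (fun x => \prod_(p <- ps) (1 + be ^+ 2 * parity x p)).
apply: (@le_trans _ _ (qmean q (fun ps => (th - (4 * th)^-1) + (4 * th)^-1 * M ps))).
  apply: le_qmean => ps _; rewrite mulN1r.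
  have := @planted_local_indistinguishable be th ps (D ^~ ps) th0
    (fun g => D01 g ps) (Dps ps).
  move=> /le_trans; apply; rewrite -/(M ps); apply: eq_ler; field.
  by rewrite gt_eqF.
rewrite qmeanD qmeanZ qmean_cst//.
have -> : qmean q M = mean (fun x => mean (fun p => 1 + be ^+ 2 * parity x p) ^+ q).
  rewrite /M /mean.
  under [LHS]eq_qmean => ps _ do rewrite mulrC mulr_sumr.
  rewrite qmean_lin mulr_suml; apply: eq_bigr => x _; rewrite mulrC; congr (_ * _).
  exact: qmean_prod.
have chaos : mean (fun x => mean (fun p => 1 + be ^+ 2 * parity x p) ^+ q)
    <= expR (10 * ((q%:R * be ^+ 2) ^+ 2 / #|{: vpair n}|%:R)).
  pose c : R := q%:R * be ^+ 2 / #|{: vpair n}|%:R.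
  have cE : \sum_(p : vpair n) c ^+ 2 = (q%:R * be ^+ 2) ^+ 2 / #|{: vpair n}|%:R.
    by rewrite sumr_const -(mulr_natr (c ^+ 2)) /c; field.
  have := @pair_chaos_mgf R n (fun=> c); rewrite cE => /(_ small).
  apply: le_trans; apply: le_mean => x.
  rewrite meanD mean_cst// meanZ.
  have -> : \sum_p c * parity x p = q%:R * (be ^+ 2 * mean (parity x)).
    by rewrite -mulr_sumr /mean /c; field.
  rewrite expRM_natl; apply: lerXn2r; rewrite ?nnegrE ?expR_ge0 ?expR_ge1Dx//.
  have m1 : -1 <= mean (parity x).
    rewrite -[leLHS](mean_cst _ N0); apply: le_mean => p.
    by case/andP: (parity_norm_le1 R x p).
  have b2 : be ^+ 2 <= 1 by rewrite expr_le1.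
  by have := sqr_ge0 be; nra.
have k0 : 0 <= (4 * th)^-1 by rewrite invr_ge0 mulr_ge0// ltW.
have := ler_wpM2l k0 chaos; lra.
Qed.

End UnboundedMemory.

(** * Clustering costs of the random graphs *)

Section LabelGraphs.
Variables (R : realType) (n : nat).
Local Notation signs := {ffun 'I_n -> bool}.
Local Notation labels := {ffun vpair n -> bool}.
Local Notation sg := (sg R).
Local Notation parity := (@parity R n).
Local Notation N := (#|{: vpair n}|%:R : R).
Implicit Types (x y : signs) (g : labels) (p : vpair n) (be t : R).
Implicit Types (C : {set {set 'I_n}}).

Definition label_edges g : {set {set 'I_n}} := [set val p | p : vpair n & g p]%SET.

Lemma label_edges_card2 g e : e \in label_edges g -> #|e| = 2%N.
Proof. by case/imsetP => p _ ->; apply/eqP; exact: valP p. Qed.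

Definition label_graph g : sgraph n := SGraph (@label_edges_card2 g).

Lemma adjacent_label_graph g p : Defs.adjacent (label_graph g) p = g p.
Proof. by rewrite /Defs.adjacent /= mem_imset ?inE//; exact: val_inj. Qed.

Lemma card_vpair : 2 * N = n%:R * (n%:R - 1).
Proof.
have -> : #|{: vpair n}| = 'C(n, 2).
  rewrite card_sig -[X in 'C(X, _)]card_ord -card_draws; apply: eq_card => e.
  by rewrite !inE.
have := bin_ffact n 2; rewrite ffactnS ffactn1 => h.
rewrite -natrM mulnC h natrM; case: n => [|k]; first by rewrite !mul0r.
by rewrite /= (_ : k.+1%:R - 1 = k%:R :> R)// -natr1 addrK.
Qed.

(** A pair is charged when its label and co-membership signs differ, that is [(1 - product) / 2]. *)
Lemma cost_label_graph g C : (cost (label_graph g) C)%:R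
  = N / 2 - (\sum_p sg (g p) * sg (same_part C p)) / 2.
Proof.
have cardE (P : pred (vpair n)) : #|P|%:R = \sum_p (P p)%:R :> R.
  rewrite -sum1_card natr_sum big_mkcond; apply: eq_bigr => p _.
  by rewrite unfold_in; case: (P p).
rewrite /cost natrD ![in LHS]cardE -big_split /=.
have -> : N = \sum_(p : vpair n) 1 by rewrite sumr_const.
rewrite -mulrBl -sumrB mulr_suml; apply: eq_bigr => p _.
rewrite adjacent_label_graph.
by case: (g p) (same_part C p) => [] [] /=; rewrite /sg; field.
Qed.

Lemma same_partE C p u v : clustering C -> val p = [set u; v]%SET ->
  same_part C p = (finset.pblock C u == finset.pblock C v).
Proof.
move=> /and3P[/eqP covC trC _] pE.
have cov w : w \in finset.cover C by rewrite covC.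
rewrite eq_pblock//; apply/idP/idP.
  case/exists_inP => B BC; rewrite pE finset.subUset !finset.sub1set => /andP[uB vB].
  by rewrite (def_pblock trC BC uB).
move=> vu; apply/exists_inP; exists (finset.pblock C u); first exact: pblock_mem.
by rewrite pE finset.subUset !finset.sub1set mem_pblock cov.
Qed.

(* Choosing an independent sign for every cluster turns the co-membership
   indicator into an average of rank-one sign matrices, so that cut norms
   control the cost of clusterings with arbitrarily many parts. *)
Lemma cost_ge g C (tau : R) : clustering C ->
  (forall y, `|\sum_p sg (g p) * parity y p| <= tau) ->
  N / 2 - 3 / 2 * tau <= (cost (label_graph g) C)%:R.
Proof.
move=> clC cut; rewrite cost_label_graph.
pose y (h : {ffun {set 'I_n} -> bool}) : signs := [ffun u => h (finset.pblock C u)].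
have same p : (same_part C p)%:R = mean (fun h => parity (y h) p).
  have [_ pE] := svalP (vpair_endpoints n) p.
  rewrite (same_partE clC pE) -(mean_sg2 R); apply: eq_mean => h.
  by rewrite parityE !ffunE.
have sum_same : \sum_p sg (g p) * (same_part C p)%:R <= tau.
  under eq_bigr do rewrite same -meanZ.
  rewrite -mean_sum -[leRHS](mean_cst _ (@card_signs_gt0 {set 'I_n})).
  by apply: le_mean => h; exact: le_trans (ler_norm _) (cut (y h)).
have sum_all : - tau <= \sum_p sg (g p).
  have := cut [ffun=> true]; rewrite ler_norml => /andP[+ _].
  rewrite (eq_bigr (fun p => sg (g p)))// => p _.
  by rewrite /parity big1 ?mulr1// => u _; rewrite ffunE.
(* The co-membership sign is twice the indicator minus one, so the sum is at most
   [2 * tau + tau]. *)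
have -> : \sum_p sg (g p) * sg (same_part C p)
    = 2 * (\sum_p sg (g p) * (same_part C p)%:R) - \sum_p sg (g p).
  rewrite mulr_sumr -sumrB; apply: eq_bigr => p _.
  by case: (same_part C p) (g p) => [] []; rewrite /sg /=; ring.
lra.
Qed.

(** The clustering into the fibres of [x] has co-membership sign [parity x p]. *)
Lemma min_cost_planted g x : (min_cost (label_graph g))%:R
  <= N / 2 - (\sum_p sg (g p) * parity x p) / 2.
Proof.
pose C := preim_partition x [set: 'I_n]%SET.
have clC : clustering C by exact: preim_partitionP.
have /and3P[/eqP covC trC _] := clC.
apply: (@le_trans _ _ (cost (label_graph g) C)%:R); first by rewrite ler_nat min_cost_le.
rewrite cost_label_graph; apply: eq_ler; congr (_ - _ / _); apply: eq_bigr => p _.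
have [_ pE] := svalP (vpair_endpoints n) p; congr (_ * _).
rewrite (same_partE clC pE) eq_pblock ?covC// pblock_equivalence_partition ?inE//; last first.
  by split=> // /eqP ->.
rewrite parityE.
by case: (x _) (x _) => [] [] /=; rewrite /sg ?mulr1 ?mul1r ?mulrNN ?mulr1.
Qed.

Lemma planted_sum (I : finType) be (F : I -> signs -> labels -> R) :
  planted be (fun x g => \sum_i F i x g) = \sum_i planted be (F i).
Proof.
rewrite /planted exchange_big; apply: eq_bigr => o _.
by rewrite mulr_sumr.
Qed.

Lemma expR_ge_indic (b : bool) (a : R) : (b -> 0 <= a) -> b%:R <= expR a.
Proof.
case: b => [/(_ isT) a0|_]; last exact: expR_ge0.
by rewrite -[leLHS]expR0 ler_expR.
Qed.

Section Typical.
Hypothesis n100 : (100 <= n)%N.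
Let rn : R := n%:R.
Let dev : R := 7 * (rn * Num.sqrt rn).

Let rn100 : 100 <= rn.
Proof. by rewrite (ler_nat R 100). Qed.

(** Chernoff parameter: the deviation contributes [7 * n] to the exponent, the moment bound costs at
    most [8 * lam ^+ 2 * N <= 4 * n], and the remaining [3 * n] pays for a union over sign
    vectors. *)
Let lam : R := (Num.sqrt rn)^-1.

Let lam_sqr : lam ^+ 2 * rn = 1.
Proof.
have := rn100 => r100.
by rewrite /lam exprVn sqr_sqrtr ?mulVf// ?gt_eqF//; lra.
Qed.

Let lam_dev : lam * dev = 7 * rn.
Proof.
have r100 := rn100.
have s0 : Num.sqrt rn != 0 by rewrite gt_eqF// sqrtr_gt0; lra.
by rewrite /lam /dev; field.
Qed.

Let lam_N : lam ^+ 2 * N <= rn / 2.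
Proof.
have r100 := rn100; have l0 := sqr_ge0 lam.
by have := lam_sqr; have := card_vpair; rewrite -/rn; nra.
Qed.

Let lam_gt0 : 0 < lam.
Proof. by have r100 := rn100; rewrite invr_gt0 sqrtr_gt0; lra. Qed.

Let exp_le (c : R) : 1 <= c -> expR (- (c * rn)) <= 1 / 100 / c.
Proof.
move=> c1; have r100 := rn100; rewrite expRN.
have cr : 100 * c <= expR (c * rn).
  apply: le_trans (expR_ge1Dx _); nra.
have c0 : 0 < 100 * c by lra.
have -> : 1 / 100 / c = (100 * c)^-1 by field; rewrite gt_eqF//; lra.
by rewrite lef_pV2// posrE// expR_gt0.
Qed.

(** A minimum cost this large forces the labels to correlate with [x] by [dev] less than expected, a
    Chernoff event for the label noise. *)
Lemma planted_tail be : 0 <= be <= 1 ->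
  planted be (fun _ g => (N / 2 - be * N / 2 + dev / 2
     < (min_cost (label_graph g))%:R)%R%:R) <= 1 / 100.
Proof.
move=> be01.
pose a x p : R := - lam * parity x p.
apply: (@le_trans _ _ (planted be (fun x g => expR (- (7 * rn)) *
    expR (\sum_p a x p * (sg (g p) - be * parity x p))))).
  apply: le_planted => // x g; rewrite -expRD; apply: expR_ge_indic => hlt.
  have := lt_le_trans hlt (min_cost_planted g x).
  set S := \sum_p sg (g p) * parity x p => hS.
  have -> : \sum_p a x p * (sg (g p) - be * parity x p) = lam * (be * N - S).
    have -> : be * N = \sum_(p : vpair n) be by rewrite sumr_const mulr_natr.
    rewrite /S -sumrB mulr_sumr; apply: eq_bigr => p _.
    transitivity (lam * (be * (parity x p * parity x p) - sg (g p) * parity x p)).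
      by rewrite /a; ring.
    by rewrite parity_sqr mulr1.
  have h : dev <= be * N - S by lra.
  by have := ler_wpM2l (ltW lam_gt0) h; rewrite lam_dev; lra.
rewrite plantedE -[leRHS](mean_cst _ (@card_signs_gt0 'I_n)).
apply: le_mean => x.
under eq_bigr do rewrite mulrCA.
rewrite -mulr_sumr.
apply: le_trans (ler_wpM2l (expR_ge0 _) (label_noise_mgf be01 x (a x))) _.
have -> : \sum_p a x p ^+ 2 = lam ^+ 2 * N.
  rewrite (eq_bigr (fun=> lam ^+ 2)) ?sumr_const ?mulr_natr// => p _.
  by rewrite /a mulNr sqrrN exprMn (expr2 (parity x p)) parity_sqr mulr1.
rewrite -expRD; apply: (@le_trans _ _ (expR (- (1 * rn)))).
  by rewrite ler_expR; have := lam_N; have := rn100; lra.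
by apply: le_trans (exp_le (lexx 1)) _; rewrite divr1.
Qed.

(** By [cost_ge] a cheap clustering yields a sign vector with a large cut. The union runs over the
    vector and the sign of its cut, with [2 ^+ n * exp (- 3 * n) <= exp (- 2 * n)]. *)
Lemma null_tail :
  planted (0 : R) (fun _ g => ((min_cost (label_graph g))%:R
     < N / 2 - 3 / 2 * dev)%R%:R) <= 1 / 100.
Proof.
have z01 : 0 <= (0 : R) <= 1 by rewrite lexx ler01.
pose a y (b : bool) p : R := lam * (sg b * parity y p).
apply: (@le_trans _ _ (planted 0 (fun x g => \sum_(yb : signs * bool)
   expR (- (7 * rn)) * expR (\sum_p a yb.1 yb.2 p * (sg (g p) - 0 * parity x p))))).
  apply: le_planted => // x g.
  have terms_ge0 (yb : signs * bool) : 0 <= expR (- (7 * rn)) *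
      expR (\sum_p a yb.1 yb.2 p * (sg (g p) - 0 * parity x p)).
    by rewrite mulr_ge0 ?expR_ge0.
  case: ltP => hlt; last by apply: sumr_ge0.
  have [y cut] : exists y, ~~ (`|\sum_p sg (g p) * parity y p| <= dev).
    apply/existsP; rewrite -negb_forall; apply/negP => /forallP cut.
    have [C clC CE] := min_cost_attained (label_graph g).
    by have := cost_ge clC cut; rewrite CE leNgt hlt.
  rewrite -ltNge in cut; pose b := 0 <= \sum_p sg (g p) * parity y p.
  rewrite (bigD1 (y, b)) //=; apply: ler_wpDr; first by rewrite sumr_ge0.
  rewrite -expRD -[leLHS]expR0 ler_expR.
  have -> : \sum_p a y b p * (sg (g p) - 0 * parity x p)
      = lam * `|\sum_p sg (g p) * parity y p|.
    have -> : `|\sum_p sg (g p) * parity y p| = sg b * \sum_p sg (g p) * parity y p.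
      rewrite /b /sg; case: leP => h; first by rewrite mul1r ger0_norm.
      by rewrite mulN1r ltr0_norm.
    by rewrite !mulr_sumr; apply: eq_bigr => p _; rewrite /a; ring.
  by have := ler_wpM2l (ltW lam_gt0) (ltW cut); rewrite lam_dev; lra.
rewrite planted_sum.
apply: (@le_trans _ _ (\sum_(yb : signs * bool) expR (- (3 * rn)))).
  apply: ler_sum => -[y b] _ /=.
  rewrite plantedE -[leRHS](mean_cst _ (@card_signs_gt0 'I_n)).
  apply: le_mean => x.
  under eq_bigr do rewrite mulrCA.
  rewrite -mulr_sumr.
  apply: le_trans (ler_wpM2l (expR_ge0 _) (label_noise_mgf z01 x (a y b))) _.
  have -> : \sum_p a y b p ^+ 2 = lam ^+ 2 * N.
    rewrite (eq_bigr (fun=> lam ^+ 2)) ?sumr_const ?mulr_natr// => p _.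
    by rewrite /a 2!exprMn (expr2 (parity y p)) parity_sqr (expr2 (sg b)) sg_sqr !mulr1.
  by rewrite -expRD ler_expR; have := lam_N; lra.
rewrite sumr_const card_prod card_ffun card_ord card_bool -(mulr_natl (expR _)) natrM natrX.
have two_le : (2 : R) ^+ n <= expR (1 * rn).
  rewrite /rn expRM_natr; apply: lerXn2r; rewrite ?nnegrE ?expR_ge0//.
  by apply: le_trans (expR_ge1Dx _); lra.
apply: (@le_trans _ _ (2 * expR (- (2 * rn)))).
  rewrite mulrAC [_ * 2]mulrC ler_pM2l//.
  apply: le_trans (ler_wpM2r (expR_ge0 _) two_le) _.
  by rewrite -expRD ler_expR; lra.
have := exp_le (_ : 1 <= 2); have h12 : (1 : R) <= 2 by lra.
by move=> /(_ h12); lra.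
Qed.

End Typical.
End LabelGraphs.

(** * Measurability in the seed *)

Section SeedMeasurability.
Variable R : realType.

(** The left side is the integral of the weighted indicators, so a bound at every point passes to
    it. *)
Lemma le_sum_probability (d : measure_display) (T : measurableType d)
    (P : probability T R) (I : finType) (c : I -> R) (A : I -> set T) (M : R) :
    (forall i, 0 <= c i) -> (forall i, measurable (A i)) ->
    (forall w, \sum_i c i * \1_(A i) w <= M) ->
  \sum_i c i * fine (P (A i)) <= M.
Proof.
move=> c0 mA cM; rewrite -lee_fin -sumEFin.
have mindic i : measurable_fun setT (fun w => (\1_(A i) w : R)%:E).
  by apply/measurable_EFinP; exact: measurable_indic.
have mc i : measurable_fun setT (fun w => (c i * \1_(A i) w)%:E).
  apply/measurable_EFinP; apply: measurable_funM => //; exact: measurable_indic.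
have term i : (c i * fine (P (A i)))%:E = (\int[P]_w (c i * \1_(A i) w)%:E)%E.
  under eq_integral do rewrite EFinM.
  rewrite ge0_integralZl_EFin//.
  by rewrite integral_indic// setIT EFinM fineK// fin_num_measure.
rewrite (eq_bigr (fun i => \int[P]_w (c i * \1_(A i) w)%:E)%E); last by move=> i _; exact: term.
rewrite -ge0_integral_sum//; last first.
  by move=> i w _; rewrite lee_fin mulr_ge0// indicE ler0n.
apply: (@le_trans _ _ (\int[P]_w (cst M%:E) w)%E).
  apply: ge0_le_integral => //.
  - by move=> w _; rewrite sume_ge0// => i _; rewrite lee_fin mulr_ge0// indicE ler0n.
  - exact: emeasurable_sum.
  - by move=> w _; rewrite sumEFin lee_fin.
by rewrite integral_cst //= probability_setT mule1.
Qed.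

Lemma measurable_run (n s : nat) (A : rand_alg R n s) (G : sgraph n)
    (ps : seq (vpair n)) : measurable_outcome (fun w : seed A => run G w ps).
Proof.
suff gen t (o : seed A -> outcome R s) : measurable_outcome o ->
    measurable_outcome (fun w => run_from G w t (o w) ps).
  by apply: gen; exact: start_measurable.
elim: ps t o => [//|p ps IH] t o [mo1 mo2]; apply: (IH t.+1).
set b := Defs.adjacent G p.
have ms m := @step_measurable R n s A t m p b.
split=> [m'|B mB].
  (* The memory before the query takes finitely many values, so the event is a finite union. *)
  rewrite (_ : mkset _ = \bigcup_(m in setT)
      ([set w | o w = inl m] `&` [set w | step w t m p b = inl m'])).
    apply: fin_bigcup_measurable => [|m _]; first exact: finite_finset.
    by apply: measurableI; [exact: mo1|exact: (ms m).1].
  apply/seteqP; split => w /=; last by case=> m _ [/= -> ->].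
  by case E: (o w) => [m|a] // h; exists m.
rewrite (_ : mkset _ = [set w | exists2 a, B a & o w = inr a] `|`
    \bigcup_(m in setT) ([set w | o w = inl m]
      `&` [set w | exists2 a, B a & step w t m p b = inr a])).
  apply: measurableU; first exact: mo2.
  apply: fin_bigcup_measurable => [|m _]; first exact: finite_finset.
  by apply: measurableI; [exact: mo1|exact: (ms m).2].
apply/seteqP; split => w /=.
  case E: (o w) => [m|a'] [a Ba h].
    by right; exists m => //; split => //; exists a.
  by left; exists a.
case=> [[a Ba ->]|[m _ [/= -> h]]] //; by exists a.
Qed.

Lemma measurable_accurate (n s : nat) (A : rand_alg R n s) (G : sgraph n)
    (eps : R) (ps : seq (vpair n)) :
  measurable [set w : seed A | accurate G eps w ps].
Proof.
pose i : interval R := `[(min_cost G)%:R - eps * n%:R ^+ 2,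
                         (min_cost G)%:R + eps * n%:R ^+ 2]%R.
pose B : set R := [set` i].
have mB : measurable B := @measurable_itv R i.
have := (measurable_run A G ps).2 B mB; congr measurable.
apply/seteqP; split => w /= [a].
  by rewrite /B /= /i in_itv /= => ha runE; exists a; rewrite // ler_distl.
by move=> runE; rewrite ler_distl => ha; exists a; rewrite // /B /= /i in_itv.
Qed.

End SeedMeasurability.

(** * Fixing the seed and thresholding the output *)

Section Distinguisher.
Variables (R : realType) (n s : nat) (A : rand_alg R n s) (eps : R) (q : nat).
Local Notation signs := {ffun 'I_n -> bool}.
Local Notation labels := {ffun vpair n -> bool}.
Local Notation N := (#|{: vpair n}|%:R : R).
Implicit Types (g : labels) (ps : seq (vpair n)) (w : seed A).

Let acc_set g ps := [set w : seed A | accurate (label_graph g) eps w ps].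
Let acc w g ps : R := \1_(acc_set g ps) w.

(** The success probabilities under the two laws add up to a nonnegative combination of seed
    probabilities, so a bound for each fixed seed suffices. *)
Lemma seed_averaging be M : 0 <= be <= 1 ->
  (forall G, 99 / 100 <= success_prob A G eps q) ->
  (forall w, planted be (fun _ g => qmean q (acc w g))
             + planted 0 (fun _ g => qmean q (acc w g)) <= M) ->
  198 / 100 <= M.
Proof.
move=> be01 succ accM; have z01 : 0 <= (0 : R) <= 1 by rewrite lexx ler01.
pose W b (o : signs * labels) := planted_weight (if b then be else 0) o.
have expand (X : labels -> seq (vpair n) -> R) :
    planted be (fun _ g => qmean q (X g)) + planted 0 (fun _ g => qmean q (X g))
    = \sum_(i : (bool * (signs * labels)) * q.-tuple (vpair n))
        W i.1.1 i.1.2 / #|{: q.-tuple (vpair n)}|%:R * X i.1.2.2 i.2.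
  rewrite -(pair_bigA _ (fun (i : bool * (signs * labels)) (ps : q.-tuple (vpair n)) =>
    W i.1 i.2 / #|{: q.-tuple (vpair n)}|%:R * X i.2.2 ps)).
  rewrite -(pair_bigA _ (fun (b : bool) (o : signs * labels) => \sum_(ps : q.-tuple (vpair n))
    W b o / #|{: q.-tuple (vpair n)}|%:R * X o.2 ps)) big_bool /= /planted.
  congr (_ + _); apply: eq_bigr => o _; rewrite -qmean_tuple /mean mulr_suml mulr_sumr;
    by apply: eq_bigr => ps _; rewrite /W; ring.
apply: (@le_trans _ _ (planted be (fun _ g => success_prob A (label_graph g) eps q)
    + planted 0 (fun _ g => success_prob A (label_graph g) eps q))).
  have -> : 198 / 100 = planted be (fun (_ : signs) (_ : labels) => 99 / 100)
      + planted 0 (fun (_ : signs) (_ : labels) => 99 / 100) :> R.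
    by rewrite !planted_cst; lra.
  by apply: lerD; apply: le_planted => // x g; exact: succ.
have succE g : success_prob A (label_graph g) eps q
    = qmean q (fun ps => fine (seed_prob A (acc_set g ps))).
  by rewrite -qmean_tuple.
have -> : (fun (_ : signs) g => success_prob A (label_graph g) eps q)
    = (fun _ g => qmean q (fun ps => fine (seed_prob A (acc_set g ps)))).
  by apply/funext => x; apply/funext => g; rewrite succE.
rewrite (expand (fun g ps => fine (seed_prob A (acc_set g ps)))).
apply: (@le_sum_probability R _ _ (seed_prob A) _ _
  (fun i : (bool * (signs * labels)) * q.-tuple (vpair n) => acc_set i.1.2.2 i.2)).
- by move=> [[b o] ps] /=; rewrite divr_ge0// planted_weight_ge0//; case: b.
- by move=> i; exact: measurable_accurate.
- by move=> w; rewrite -(expand (fun g ps => acc w g ps)); exact: accM.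
Qed.

Variables (T : R) (w : seed A).

(** Keeping only the comparison of the output with [T] makes the state space finite, with
    [2 ^+ s + 2] elements. *)
Definition threshold_state (o : outcome R s) : s.-tuple bool + bool :=
  match o with inl m => inl m | inr a => inr (a < T) end.

Definition threshold_step t (m : s.-tuple bool + bool) p b : s.-tuple bool + bool :=
  match m with
  | inl m' => threshold_state (step w t m' p b)
  | inr d => inr d
  end.

Definition below (m : s.-tuple bool + bool) : R := (m == inr true)%:R.

Lemma below01 m : 0 <= below m <= 1.
Proof. by rewrite /below ler0n lern1; case: eqP. Qed.

Lemma memory_threshold g t (o : outcome R s) ps :
  memory threshold_step g t (threshold_state o) ps
    = threshold_state (run_from (label_graph g) w t o ps).
Proof.
elim: ps t o => [//|p ps IH] t o /=; rewrite -IH adjacent_label_graph.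
by case: o.
Qed.

Definition verdict g ps : R :=
  below (memory threshold_step g 0 (threshold_state (start w)) ps).

Lemma verdictE g ps a : run (label_graph g) w ps = inr a -> verdict g ps = (a < T)%R%:R.
Proof. by move=> runE; rewrite /verdict memory_threshold -/(run _ _ _) runE /below /=; case: (a < T). Qed.

Lemma verdict01 g ps : 0 <= verdict g ps <= 1.
Proof. exact: below01. Qed.

Lemma verdict_ignores ps p : p \notin ps -> ignores (verdict ^~ ps) p.
Proof.
move=> pps g; suff h t m :
    memory threshold_step (flip p g) t m ps = memory threshold_step g t m ps.
  by rewrite /verdict h.
elim: ps t m pps => [//|p' ps IH] t m; rewrite inE negb_or => /andP[pp' pps] /=.
by rewrite ffunE eq_sym (negbTE pp') IH.
Qed.

End Distinguisher.

(** * Accuracy distinguishes the planted law from the null law *)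

Lemma plantedD (R : realType) n (be : R) F G :
  planted be (fun x (g : {ffun vpair n -> bool}) => F x g + G x g)
    = planted be F + planted be G.
Proof. by rewrite /planted -big_split; apply: eq_bigr => o _; rewrite mulrDr. Qed.

Section Reduction.
Variables (R : realType) (n s : nat) (A : rand_alg R n s) (eps : R) (q : nat).
Local Notation signs := {ffun 'I_n -> bool}.
Local Notation labels := {ffun vpair n -> bool}.
Local Notation N := (#|{: vpair n}|%:R : R).
Let rn : R := n%:R.
Let be := 12 * eps.
(** Lies [eps * n ^+ 2] below the bound of [null_tail], so accurate outputs on typical null graphs
    are at least [T]. *)
Let T := N / 2 - 3 / 2 * (7 * (rn * Num.sqrt rn)) - eps * rn ^+ 2.

(** For a fixed seed, success means an output below [T] on typical planted graphs and at least [T]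
    on typical null graphs. A close verdict limits the total success to [1 + 9 / 10 + 2 / 100], less
    than [198 / 100]. *)
Lemma accurate_distinguishes : (100 <= n)%N -> 0 < eps -> be <= 1 ->
    30 <= eps * Num.sqrt rn ->
    (forall G, 99 / 100 <= success_prob A G eps q) ->
  ~ (forall w : seed A,
       planted be (fun _ g => qmean q (verdict T w g))
       - planted 0 (fun _ g => qmean q (verdict T w g)) <= 9 / 10).
Proof.
move=> n100 eps0 be1 eps30 succ close.
have be01 : 0 <= be <= 1 by rewrite be1 andbT /be; lra.
have z01 : 0 <= (0 : R) <= 1 by rewrite lexx ler01.
have rn100 : 100 <= rn by rewrite (ler_nat R 100).
have N0 : (0 < #|{: vpair n}|)%N.
  by rewrite -(ltr0n R); have := card_vpair R n; rewrite -/rn; nra.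
have sqrt0 : 0 < Num.sqrt rn by rewrite sqrtr_gt0; lra.
have sqrtE : Num.sqrt rn ^+ 2 = rn by rewrite sqr_sqrtr//; lra.
(* The planted gain [be * N / 2] is nearly [3 * eps * n ^+ 2]. After two accuracy radii about
   [eps * n ^+ 2 >= 30 * n * sqrt n] is left, against fluctuations of [14 * n * sqrt n]. *)
have gap : N / 2 - be * N / 2 + 7 * (rn * Num.sqrt rn) / 2 + eps * rn ^+ 2 < T.
  have NE : N = rn * (rn - 1) / 2 by rewrite -card_vpair; field.
  have noise : 30 * (rn * Num.sqrt rn) <= eps * rn ^+ 2.
    have -> : eps * rn ^+ 2 = eps * Num.sqrt rn * (rn * Num.sqrt rn).
      by rewrite -[in RHS]mulrA (mulrCA (Num.sqrt rn)) -expr2 sqrtE expr2.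
    by rewrite ler_wpM2r// mulr_ge0 ?ltW//; lra.
  have e1 : eps * rn * 100 <= eps * rn * rn.
    by rewrite ler_wpM2l// mulr_ge0 ?ltW//; lra.
  have rs : 0 < rn * Num.sqrt rn by rewrite mulr_gt0//; lra.
  have -> : be * N / 2 = 3 * (eps * rn * rn) - 3 * (eps * rn).
    by rewrite NE /be; field.
  rewrite /T expr2 mulrA in noise *; have : 0 < eps * rn by rewrite mulr_gt0//; lra.
  lra.
suff : 198 / 100 <= 192 / 100 :> R by lra.
apply: (seed_averaging be01 succ) => w.
pose bad1 (g : labels) : R := (N / 2 - be * N / 2 + 7 * (rn * Num.sqrt rn) / 2
     < (min_cost (label_graph g))%:R)%R%:R.
pose bad0 (g : labels) : R := ((min_cost (label_graph g))%:R
     < N / 2 - 3 / 2 * (7 * (rn * Num.sqrt rn)))%R%:R.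
have acc1 g ps : \1_[set w : seed A | accurate (label_graph g) eps w ps] w
    <= verdict T w g ps + bad1 g.
  have /andP[v0 v1] := verdict01 T w g ps.
  have b0 : 0 <= bad1 g by rewrite ler0n.
  rewrite indicE; case: (boolP (w \in _)) => [|_]; last by rewrite addr_ge0.
  rewrite inE /= => -[a runE]; rewrite ler_distl => /andP[_ ha].
  rewrite (verdictE T runE) /bad1; case: (ltP _ (min_cost _)%:R) => hm.
    by rewrite lerDr ler0n.
  have -> : a < T by move: gap; rewrite /rn; lra.
  by rewrite lerDl ler0n.
have acc0 g ps : \1_[set w : seed A | accurate (label_graph g) eps w ps] w
    <= (1 + -1 * verdict T w g ps) + bad0 g.
  have /andP[v0 v1] := verdict01 T w g ps.
  have b0 : 0 <= bad0 g by rewrite ler0n.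
  rewrite indicE; case: (boolP (w \in _)) => [|_]; last by rewrite mulN1r addr_ge0// subr_ge0.
  rewrite inE /= => -[a runE]; rewrite ler_distl => /andP[ha _].
  rewrite mulN1r; move: v0 v1; rewrite (verdictE T runE) /bad0.
  case: (ltP _ (_ - 3 / 2 * _)) => hm v0 v1; first by rewrite lerDr subr_ge0.
  have -> : a < T = false by apply/negbTE; rewrite -leNgt /T /rn; lra.
  by rewrite subr0 addr0.
have h1 : planted be (fun _ g => qmean q (fun ps =>
      \1_[set w : seed A | accurate (label_graph g) eps w ps] w))
    <= planted be (fun _ g => qmean q (verdict T w g)) + planted be (fun _ g => bad1 g).
  rewrite -plantedD; apply: le_planted => // x g.
  rewrite -[X in _ + X](qmean_cst (bad1 g) q N0) -qmeanD.
  by apply: le_qmean => ps _; exact: acc1.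
have h0 : planted 0 (fun _ g => qmean q (fun ps =>
      \1_[set w : seed A | accurate (label_graph g) eps w ps] w))
    <= planted 0 (fun (_ : signs) (_ : labels) => 1)
       + - planted 0 (fun _ g => qmean q (verdict T w g)) + planted 0 (fun _ g => bad0 g).
  have -> : - planted 0 (fun _ g => qmean q (verdict T w g))
      = planted 0 (fun _ g => qmean q (fun ps => -1 * verdict T w g ps)).
    rewrite /planted -sumrN; apply: eq_bigr => o _.
    by rewrite qmeanZ; ring.
  rewrite -!plantedD; apply: le_planted => // x g.
  rewrite -[X in _ + X](qmean_cst (bad0 g) q N0) -[X in X + _ + _](qmean_cst 1 q N0).
  by rewrite -!qmeanD; apply: le_qmean => ps _; exact: acc0.
have t1 := planted_tail n100 be01; have t0 := null_tail R n100.
rewrite planted_cst in h0; have := close w; move: t1 t0 h1 h0.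
rewrite -/rn -/(planted be (fun _ g => bad1 g)) -/(planted 0 (fun _ g => bad0 g)).
lra.
Qed.
End Reduction.

(** * The bound at a fixed number of vertices *)

Section FixedSize.
Variables (R : realType) (n s : nat) (A : rand_alg R n s) (eps gamma : R) (q : nat).
Local Notation N := (#|{: vpair n}|%:R : R).
Let rn : R := n%:R.
Let rt : R := Num.sqrt rn.
Variable K : R.
Hypothesis K_ge : 1000 * 1000 * 1000 <= K.
Hypothesis n100 : (100 <= n)%N.
Hypothesis eps_range : 0 < eps < 5 / 100.
Hypothesis eps30 : 30 <= eps * rt.
Hypothesis gamma_gt0 : 0 < gamma.
Hypothesis gamma_rt : 1 <= gamma * rt.
Hypothesis space : s%:R <= gamma * rt.
Hypothesis succ : forall G : sgraph n, 99 / 100 <= success_prob A G eps q.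

Let rn100 : 100 <= rn. Proof. by rewrite (ler_nat R 100). Qed.
Let rt_gt0 : 0 < rt. Proof. by have := rn100; rewrite sqrtr_gt0; lra. Qed.
Let rt_sqr : rt ^+ 2 = rn. Proof. by have := rn100; rewrite sqr_sqrtr//; lra. Qed.
Let N_ge : rn ^+ 2 / 4 <= N.
Proof. by have := card_vpair R n; have := rn100; rewrite -/rn; nra. Qed.
Let N_gt0 : (0 < #|{: vpair n}|)%N.
Proof. by rewrite -(ltr0n R); have := N_ge; have := rn100; nra. Qed.
Let be01 : 0 <= 12 * eps <= 1.
Proof. by have := eps_range; lra. Qed.

Let K_gt0 : 0 < K.
Proof. by move: K_ge; lra. Qed.

Let contra (P : Prop) : (forall w T,
    planted (12 * eps) (fun _ g => qmean q (@verdict R n s A T w g))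
    - planted 0 (fun _ g => qmean q (verdict T w g)) <= 9 / 10) -> P.
Proof.
move=> close; have /andP[e0 _] := eps_range; have /andP[_ b1] := be01.
by case: (accurate_distinguishes n100 e0 b1 eps30 succ) => w; exact: close.
Qed.

Lemma too_few_queries : q%:R * K < rn / eps ^+ 2 -> False.
Proof.
move=> few; apply: contra => w T.
have /andP[e0 e1] := eps_range; have r100 := rn100.
have e2 : 0 < eps ^+ 2 by rewrite exprn_gt0.
move: few; rewrite ltr_pdivlMr// => few.
have few' : q%:R * (12 * eps) ^+ 2 <= rn / 1000.
  have : 0 <= q%:R * eps ^+ 2 by rewrite mulr_ge0 // ltW.
  have -> : q%:R * (12 * eps) ^+ 2 = 144 * (q%:R * eps ^+ 2) by ring.
  move: few; rewrite mulrAC; move: (q%:R * eps ^+ 2) => u few u0.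
  by have := ler_wpM2l u0 K_ge; lra.
have N0 : 0 < N by rewrite ltr0n.
set z := (q%:R * (12 * eps) ^+ 2) ^+ 2 / N.
have z0 : 0 <= z by rewrite divr_ge0 ?sqr_ge0// ltW.
have z_le : z <= 1 / 1000.
  rewrite ler_pdivrMr//; apply: (@le_trans _ _ ((rn / 1000) ^+ 2)).
    apply: lerXn2r => //; rewrite nnegrE; last by lra.
    by rewrite mulr_ge0 ?sqr_ge0.
  by have := N_ge; rewrite expr2; nra.
(* With this [th] the advantage is at most [1 / 10 + (10 * z + 200 * z ^+ 2) / (4 / 10)]. *)
have th0 : (0 : R) < 1 / 10 by lra.
have small : z <= 1 / 256 by lra.
apply: le_trans (queries_indistinguishable N_gt0 be01 th0
  (verdict01 T w) (@verdict_ignores R n s A T w) small) _.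
rewrite -/z; have := @expR_le_quadratic R (10 * z).
have h : 10 * z <= 1 / 2 by lra.
move=> /(_ h); nra.
Qed.

(** With [S = gamma * rt], the information has two main terms, [q * S] and [q * eps ^+ 2 * S ^+ 2];
    each branch of the minimum bounds one of them by [n ^+ 2 / K]. *)
Lemma too_few_queries_bounded_memory : gamma < 1 ->
  q%:R * K < rn / (eps ^+ 2 * Num.sqrt gamma) ->
  q%:R * K < rn * rt / gamma -> False.
Proof.
move=> gamma_lt1 few1 few2; apply: contra => w T.
have /andP[e0 e1] := eps_range; have r100 := rn100; have h0 := rt_gt0.
have q0 : 0 <= (q%:R : R) by [].
pose S := gamma * rt; have S1 : 1 <= S by exact: gamma_rt.
have sg0 : 0 < Num.sqrt gamma by rewrite sqrtr_gt0.
have sg_sqr : Num.sqrt gamma ^+ 2 = gamma by rewrite sqr_sqrtr// ltW.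
(* The term in [S ^+ 2] involves [gamma ^+ 2], which is bounded through [gamma < 1]. *)
have sg_ge : gamma ^+ 2 <= Num.sqrt gamma.
  have sg1 : Num.sqrt gamma <= 1 by rewrite -sqrtr1 ler_wsqrtr// ltW.
  by move: sg0 sg_sqr sg1; move: (Num.sqrt gamma) => v; nra.
have X_le : K * (q%:R * S) <= rn ^+ 2.
  move: few2; rewrite ltr_pdivlMr// => /ltW few2.
  have := ler_wpM2r (ltW h0) few2.
  have -> : rn * rt * rt = rn ^+ 2 by rewrite -mulrA -expr2 rt_sqr -expr2.
  by apply: le_trans; rewrite /S; apply: eq_ler; ring.
have e2 : 0 < eps ^+ 2 by rewrite exprn_gt0.
have Y_le : K * (q%:R * (eps ^+ 2 * S ^+ 2)) <= rn ^+ 2.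
  move: few1; rewrite ltr_pdivlMr ?mulr_gt0// => /ltW few1.
  have qe : 0 <= q%:R * K * eps ^+ 2 
    by apply: mulr_ge0 (ltW e2); apply: mulr_ge0 (ltW K_gt0).
  have few3 : q%:R * K * eps ^+ 2 * gamma ^+ 2 <= rn.
    apply: le_trans (ler_wpM2l qe sg_ge) _; apply: le_trans few1.
    by apply: eq_ler; ring.
  have rn0 : 0 <= rn by lra.
  have := ler_wpM2r rn0 few3; rewrite -expr2; apply: le_trans.
  by rewrite /S exprMn rt_sqr; apply: eq_ler; ring.
pose L : R := ln #|{: s.-tuple bool + bool}|%:R.
have cardE : (#|{: s.-tuple bool + bool}|%:R : R) = 2 ^+ s + 2.
  by rewrite card_sum card_tuple card_bool natrD natrX.
have p1 : 1 <= (2 : R) ^+ s by rewrite exprn_ege1//; lra.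
have L0 : 0 <= L by rewrite ln_ge0// cardE; lra.
(* [2 ^+ s + 2 <= 2 ^+ (s + 2) <= exp (s + 2)], and [1 <= S] absorbs the constant. *)
have L_le : L <= 3 * S.
  apply: (@le_trans _ _ (s%:R + 2)); last by rewrite /S; move: space S1; rewrite /S; lra.
  rewrite /L cardE -ler_expR lnK ?posrE; last by lra.
  apply: (@le_trans _ _ (2 ^+ (s + 2))); first by rewrite exprD expr2; lra.
  rewrite -natrD -[(s + 2)%:R]mulr1 expRM_natl; apply: lerXn2r; rewrite ?nnegrE ?expR_ge0//.
  by apply: le_trans (expR_ge1Dx _); lra.
have info : q%:R * information_bound (s.-tuple bool + bool)%type (12 * eps)
    <= rn ^+ 2 / 200.
  have L2 : L ^+ 2 <= 9 * S ^+ 2.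
    have -> : 9 * S ^+ 2 = (3 * S) ^+ 2 by ring.
    by apply: lerXn2r; rewrite ?nnegrE//; lra.
  have S2 : 1 <= S ^+ 2 by rewrite exprn_ege1.
  have bound : information_bound (s.-tuple bool + bool)%type (12 * eps)
      <= 256 * S + 2000 * 2000 * (eps ^+ 2 * S ^+ 2).
    rewrite /information_bound -/L.
    have := ler_wpM2l (ltW e2) (_ : 4 * L ^+ 2 + 18 <= 54 * S ^+ 2).
    have hyp : 4 * L ^+ 2 + 18 <= 54 * S ^+ 2 by lra.
    move=> /(_ hyp); have : 0 <= eps ^+ 2 * S ^+ 2 by rewrite mulr_ge0 ?sqr_ge0.
    by move: L_le S1; rewrite exprMn; lra.
  apply: le_trans (ler_wpM2l q0 bound) _.
  have := sqr_ge0 rn.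
  have X0 : 0 <= q%:R * S by rewrite mulr_ge0//; lra.
  have Y0 : 0 <= q%:R * (eps ^+ 2 * S ^+ 2) by rewrite mulr_ge0// mulr_ge0 ?sqr_ge0.
  have := ler_wpM2r X0 K_ge; have := ler_wpM2r Y0 K_ge; lra.
have N0 : 0 < N by rewrite ltr0n.
have th01 : 0 < (1 / 10 : R) <= 1 by apply/andP; split; lra.
apply: le_trans (bounded_memory_indistinguishable _ _ N_gt0 q be01 th01 (@below01 R s)) _.
rewrite mulrA.
have : q%:R * information_bound (s.-tuple bool + bool)%type (12 * eps) / (4 * (1 / 10) * N)
    <= 1 / 10.
  rewrite ler_pdivrMr; last by rewrite mulr_gt0//; lra.
  by apply: le_trans info _; have := N_ge; lra.
lra.
Qed.

Lemma query_lower_bound_le :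
  query_lower_bound eps gamma n <= K * q%:R.
Proof.
rewrite leNgt mulrC; apply/negP; rewrite /query_lower_bound; case: (ltP gamma 1) => g1.
  by rewrite lt_min => /andP[]; exact: too_few_queries_bounded_memory.
exact: too_few_queries.
Qed.

Lemma query_lower_bound_ge0 : 0 <= query_lower_bound eps gamma n.
Proof.
rewrite /query_lower_bound; case: ifP => _; last by rewrite divr_ge0// sqr_ge0.
rewrite le_min; apply/andP; split.
  by rewrite divr_ge0// mulr_ge0 ?sqr_ge0 ?sqrtr_ge0.
by rewrite divr_ge0 ?mulr_ge0 ?sqrtr_ge0// ltW.
Qed.

End FixedSize.

(** * Passage to asymptotic parameters *)

Unset Implicit Arguments.

Theorem theorem3p1 (R : realType) (eps gamma : nat -> R) (q s : nat -> nat)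
    (Pi : forall n : nat, rand_alg R n (s n))
    (heps : \forall n \near \oo, 0 < eps n < 5 / 100)
    (heps_omega : (fun n : nat => 1 / Num.sqrt n%:R : R^o) =o_\oo
                  (eps : nat -> R^o))
    (hgamma : \forall n \near \oo, 0 < gamma n)
    (hgamma_omega : (fun n : nat => ln n%:R / Num.sqrt n%:R : R^o) =o_\oo
                    (gamma : nat -> R^o))
    (hspace : \forall n \near \oo, (s n)%:R <= gamma n * Num.sqrt n%:R)
    (hqueries : \forall n \near \oo, at_most_queries (Pi n) (q n))
    (hcorrect : \forall n \near \oo, forall G : sgraph n,
       99 / 100 <= success_prob (Pi n) G (eps n) (q n)) :
  (fun n : nat => (q n)%:R : R^o) \is
    'Omega_\oo (fun n : nat => query_lower_bound (eps n) (gamma n) n : R^o).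
Proof.
have [K K_ge] : exists K : R, 1000 * 1000 * 1000 <= K by eexists; exact: lexx.
have K0 : 0 < K by move: K_ge; lra.
move: heps_omega hgamma_omega => /eqoP eps_o /eqoP gamma_o.
(* The first constant yields [30 <= eps n * sqrt n]; the second yields [ln n <= gamma n * sqrt n],
   where [ln n >= 1]. *)
have {}eps_o := eps_o 30^-1; have {}gamma_o := gamma_o 1.
have i30 : (0 : R) < 30^-1 by rewrite invr_gt0.
have {}eps_o := eps_o i30; have {}gamma_o := gamma_o ltr01.
apply/asboolP; exists K^-1; first by rewrite invr_gt0.
near=> n.
have n100 : (100 <= n)%N by near: n; exact: nbhs_infty_ge.
have eps_range : 0 < eps n < 5 / 100 by near: n.
have gamma0 : 0 < gamma n by near: n.
have rt0 : 0 < Num.sqrt n%:R :> R.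
  by rewrite sqrtr_gt0 ltr0n; apply: leq_trans n100.
have eps30 : 30 <= eps n * Num.sqrt n%:R.
  have : `|1 / Num.sqrt n%:R| <= 30^-1 * `|eps n| by near: n.
  have /andP[e0 _] := eps_range.
  rewrite (ger0_norm (ltW e0)) ger0_norm ?divr_ge0 ?(ltW rt0)// ler_pdivrMr//.
  by lra.
have gamma_rt : 1 <= gamma n * Num.sqrt n%:R.
  have : `|ln n%:R / Num.sqrt n%:R| <= 1 * `|gamma n| by near: n.
  have ln_ge1 : 1 <= ln (n%:R : R).
    have n_ge : 100 <= (n%:R : R) by rewrite (ler_nat R 100).
    have e1 : expR 1 <= (n%:R : R).
      have -> : expR 1 = expR (1 / 2) ^+ 2 :> R.
        by rewrite -expRM_natl; congr expR; field.
      have := @expR_le_quadratic R (1 / 2) (lexx _); have := expR_ge0 (1 / 2 : R).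
      by move: (expR _) => z; nra.
    rewrite -[leLHS]expRK ler_ln ?posrE ?expR_gt0//.
    by rewrite ltr0n; apply: leq_trans n100.
  have ln0 : 0 <= ln (n%:R : R) := le_trans ler01 ln_ge1.
  rewrite mul1r (ger0_norm (ltW gamma0)) ger0_norm ?divr_ge0 ?(ltW rt0)//.
  rewrite ler_pdivrMr//.
  exact: le_trans.
have space : (s n)%:R <= gamma n * Num.sqrt n%:R by near: n.
have succ : forall G : sgraph n, 99 / 100 <= success_prob (Pi n) G (eps n) (q n).
  by near: n.
have lb := query_lower_bound_le K_ge n100 eps_range eps30 gamma0 gamma_rt space succ.
have lb0 := query_lower_bound_ge0 n (eps n) gamma0.
rewrite !ger0_norm// mulrC ler_pdivrMr// mulrC.
exact: lb.
Unshelve. all: by end_near.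
Qed.
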